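(* Let $k\ge 3$, write $\epsilon_k:=\frac{1}{2^k (k+4)!}$, and let $N$ be a sufficiently large prime number. Then there is a $k$-pseudorandom measure $\nu:\mathbb{Z}_N\to\mathbb{R}^+$ such that $$\nu(n)\ \ge\ k^{-1}2^{-k-5}\,\widetilde{\Lambda}(n)\qquad\text{for all integers } \epsilon_k N\le n\le 2\epsilon_k N .$$
   Context: Conventions. $N$ denotes a prime, thought of as tending to infinity; $\mathbb{Z}_N=\mathbb{Z}/N\mathbb{Z}$ is identified with $\{0,\dots,N-1\}$ in the usual manner; $\mathbb{R}^+$ is the set of non-negative reals. $\mathbb{E}(f(x)\mid P(x))$ is the average of $f$ over the (finite, non-empty) set of $x$ satisfying $P$, and $\mathbb{E}(f)$ is the average over the whole domain. All objects on $\mathbb{Z}_N$ may depend on $N$: $\nu$ is a family $(\nu_N)$ indexed by sufficiently large primes $N$. $O(1)$ denotes a bounded quantity and $o(1)$ one tending to $0$ as $N\to\infty$; bounds and rates may depend on $k$ and on parameters displayed as subscripts. The modified von Mangoldt function. $w=w(N)$ is a function tending to infinity sufficiently slowly with $N$ (that is: there is a function $w_0(N)\to\infty$, depending only on $k$, such that the result holds for every $w$ with $w(N)\to\infty$ and $w(N)\le w_0(N)$). $W:=\prod_{p\le w(N)}p$ is the product of the primes up to $w(N)$, $\phi$ is Euler's totient function, and for positive integers $n$, $\widetilde\Lambda(n):=\frac{\phi(W)}{W}\log(Wn+1)$ if $Wn+1$ is prime, and $\widetilde\Lambda(n):=0$ otherwise. Pseudorandomness. A measure is a function $\nu:\mathbb{Z}_N\to\mathbb{R}^+$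 with $\mathbb{E}(\nu)=1+o(1)$. A measure $\nu$ satisfies the $(m_0,t_0,L_0)$-linear forms condition if the following holds: for all $m\le m_0$, $t\le t_0$, all rationals $L_{ij}$ ($1\le i\le m$, $1\le j\le t$) with numerator and denominator at most $L_0$ in absolute value such that the $t$-tuples $(L_{ij})_{1\le j\le t}\in\mathbb{Q}^t$ are non-zero and none is a rational multiple of any other, and all $b_1,\dots,b_m\in\mathbb{Z}_N$, setting $\psi_i(\mathbf{x})=\sum_{j=1}^t L_{ij}x_j+b_i$ (with $L_{ij}$ read as elements of $\mathbb{Z}_N$, $N>L_0$ prime), one has $\mathbb{E}(\nu(\psi_1(\mathbf{x}))\cdots\nu(\psi_m(\mathbf{x}))\mid \mathbf{x}\in\mathbb{Z}_N^t)=1+o_{L_0,m_0,t_0}(1)$, with decay rate uniform in $b_1,\dots,b_m$. A measure $\nu$ satisfies the $m_0$-correlation condition if for every $1<m\le m_0$ there is a function $\tau=\tau_m:\mathbb{Z}_N\to\mathbb{R}^+$ with $\mathbb{E}(\tau^q)=O_{m,q}(1)$ for all $1\le q<\infty$ and $\mathbb{E}(\nu(x+h_1)\cdots\nu(x+h_m)\mid x\in\mathbb{Z}_N)\le\sum_{1\le i<j\le m}\tau(h_i-h_j)$ for all $h_1,\dots,h_m\in\mathbb{Z}_N$ (not necessarily distinct). A measure is $k$-pseudorandom if it satisfies the $(k\cdot 2^{k-1},3k-4,k)$-linear forms condition and the $2^{k-1}$-correlation condition. *)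

(* Defs.v *)
From HB Require Import structures.
From mathcomp Require Import all_boot all_order all_algebra.
From mathcomp Require Import all_classical all_reals all_analysis.

Set Implicit Arguments.
Unset Strict Implicit.
Unset Printing Implicit Defensive.

Import Order.TTheory GRing.Theory Num.Theory.
Import numFieldNormedType.Exports.

Local Open Scope classical_set_scope.
Local Open Scope ring_scope.

(* "N is prime and N -> oo". All asymptotic notions below are taken along this
   filter, so only the values of a ZN_family at sufficiently large primes matter;
   in particular the junk value of 'F_N at composite N is irrelevant. *)
Definition prime_oo : set_system nat := within [set N | prime N] \oo.

#[global] Instance prime_oo_proper : ProperFilter prime_oo.
Proof.
split; last exact: within_filter.
move=> [n _ nP]; have [p ltnp p_pr] := prime_above n.
by have := nP p (ltnW ltnp) p_pr.
Qed.

Section Pseudorandom.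
Variable R : realType.

Definition expect (T : finType) (f : T -> R) : R :=
  (\sum_(x : T) f x) / #|T|%:R.

(* For N prime, Z/NZ is 'F_N. *)
Definition ZN_family := forall N : nat, 'F_N -> R.

Definition nonneg_ZN_family (f : ZN_family) : Prop :=
  \forall N \near prime_oo, forall x : 'F_N, 0 <= f N x.

Definition is_measure (nu : ZN_family) : Prop :=
  nonneg_ZN_family nu /\ expect (nu N) @[N --> prime_oo] --> (1 : R).

Definition admissible_coefs (L0 m t : nat) (L : 'M[rat]_(m, t)) : Prop :=
  [/\ forall i j, `|numq (L i j)| <= L0%:Z /\ `|denq (L i j)| <= L0%:Z,
      forall i, row i L != 0 &
      forall i j, i != j -> forall c : rat, row i L != c *: row j L].

(* [ratr] reads a rational a / b as the element a * b^-1 of 'F_N. *)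
Definition affine_form (N m t : nat) (L : 'M[rat]_(m, t)) (b : 'I_m -> 'F_N)
    (i : 'I_m) (x : 'rV['F_N]_t) : 'F_N :=
  \sum_(j < t) ratr (L i j) * x 0 j + b i.

(* The threshold on N depends only on e and on m0, t0, L0 (and nu). *)
Definition linear_forms_condition (m0 t0 L0 : nat) (nu : ZN_family) : Prop :=
  forall e : R, 0 < e -> \forall N \near prime_oo,
    forall (m t : nat) (L : 'M[rat]_(m, t)) (b : 'I_m -> 'F_N),
      (m <= m0)%N -> (t <= t0)%N -> admissible_coefs L0 L ->
      `|expect (fun x : 'rV['F_N]_t =>
          \prod_(i < m) nu N (affine_form L b i x)) - 1| <= e.

Definition correlation_condition (m0 : nat) (nu : ZN_family) : Prop :=
  forall m : nat, (1 < m <= m0)%N -> exists tau : ZN_family,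
    [/\ nonneg_ZN_family tau,
        forall q : R, 1 <= q -> exists C : R,
          \forall N \near prime_oo, expect (fun x => tau N x `^ q) <= C &
        \forall N \near prime_oo, forall h : 'I_m -> 'F_N,
          expect (fun x : 'F_N => \prod_(i < m) nu N (x + h i))
            <= \sum_(i < m) \sum_(j < m | (i < j)%N) tau N (h i - h j)].

Definition pseudorandom (k : nat) (nu : ZN_family) : Prop :=
  [/\ is_measure nu,
      linear_forms_condition (k * 2 ^ k.-1) (3 * k - 4) k nu &
      correlation_condition (2 ^ k.-1) nu].

Definition primorial (x : R) : nat :=
  (\prod_(0 <= p < (Num.truncn x).+1 | prime p) p)%N.

(* Here x stands for the value w(N), so that W = primorial x. *)
Definition modified_von_Mangoldt (x : R) (n : nat) : R :=
  let W := primorial x in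
  if prime (W * n + 1) then (totient W)%:R / W%:R * ln (W * n + 1)%:R else 0.

Definition eps (k : nat) : R := (2 ^+ k * (k + 4)`!%:R)^-1.

End Pseudorandom.

(* Main.v *)
(* Instead of the truncated divisor sums of Goldston and Yildirim we
   use Selberg's optimal weights: with G = sum 1/phi(r) over the squarefree
   r <= z composed of primes p > w, and lam_d Selberg's weights (lam_1 = 1), put
   nu(n) = G (sum_{d | Wn+1} lam_d)^2. Selberg's diagonalisation gives mean value
   exactly 1 for independent divisibilities, and also bounds, by 4^{omega(a)} / G,
   the same quadratic form when the divisibility by the primes dividing a is
   prescribed. The joint densities of the events p | W psi_i(x) + 1 differ from
   independent ones by O(1/p^2) (by O(1/p) if p divides some h_i - h_j in the
   correlation condition); expanding the product over p around independence
   yields the correlations of nu up to a factor prod_{p > w} (1 + O(1/p^2)). The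
   reduction of an average over Z_N to these densities is exact up to wrap-around:
   average over shifts taken in a complete residue system modulo the relevant d's,
   all of which are at most N^{1/16}. Finally, nu(n) = G when Wn+1 is a prime > z,
   and G >= (phi(W)/W) log z by elementary means, so no zeta function and no
   asymptotic evaluation are needed. *)
Require Import Defs.
From HB Require Import structures.
From mathcomp Require Import all_boot all_order all_algebra.
From mathcomp Require Import all_classical all_reals all_analysis.
From mathcomp Require Import fintype finset.
From mathcomp Require Import ring lra zify.

Set Implicit Arguments.
Unset Strict Implicit.
Unset Printing Implicit Defensive.

Import Order.TTheory GRing.Theory Num.Theory.
Import numFieldNormedType.Exports.

Local Open Scope ring_scope.

(** * Selberg's quadratic form on subsets of a finite set of primes *)

(** The delicate point is the power of G. Each nu carries a factor G, which grows at least like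
    (phi(W)/W) log z, so an error term is harmless only if each of its m quadratic forms still saves
    a factor 1/G. Prescribing the divisibility by a set A of primes keeps this saving and loses only
    a constant to the power |A|; the errors then sum to an Euler product free of z. Squarefree
    integers are encoded as sets of primes, so that multiplicativity becomes distributivity of
    products over sums. In the correlation condition the case h_i = h_j is absorbed in tau(0). This
    value may be large, but it enters the moments of tau with weight 1/N, so it suffices that every
    power of sup nu is O(N). The constant: with m0 = k 2^(k-1) and z about N^(1/E), E = 32 m0, one
    has 2E = k 2^(k+5). Keeping W <= N^(1/4) gives Wn+1 <= z^(2E), hence log(Wn+1) <= 2E log z. *)

Section SubsetSums.
Variables (R : realFieldType) (T : finType).

Lemma prod_indicator (c : pred T) : \prod_p (c p)%:R = [forall p, c p]%:R :> R.
Proof.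
case: forallP => [h|/forallP]; first by apply: big1 => p _; rewrite h.
rewrite negb_forall => /existsP[p /negbTE cp].
by rewrite (bigD1 p) //= cp mul0r.
Qed.

Lemma prod_if_in (A : {set T}) (f : T -> R) :
  \prod_p (if p \in A then f p else 1) = \prod_(p in A) f p.
Proof. by rewrite -big_mkcond. Qed.

Lemma prod_setID (A I : {set T}) (f : T -> R) :
  \prod_(p in I) f p = \prod_(p in I :&: A) f p * \prod_(p in I :\: A) f p.
Proof.
rewrite (bigID (mem A)) /=; congr (_ * _); apply: eq_bigl => p; rewrite !inE //.
by rewrite andbC.
Qed.

Lemma prod_setUI (I J : {set T}) (f : T -> R) :
  \prod_(p in I :|: J) f p * \prod_(p in I :&: J) f p =
  \prod_(p in I) f p * \prod_(p in J) f p.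
Proof.
rewrite -!(prod_if_in _ f) -!big_split /=; apply: eq_bigr => p _; rewrite !inE.
by case: (p \in I); case: (p \in J); rewrite ?(mulr1, mul1r).
Qed.

Lemma sum_subset_prod (q : {set T}) (f : T -> R) :
  \sum_(r : {set T} | r \subset q) \prod_(p in r) f p = \prod_(p in q) (1 + f p).
Proof.
rewrite -[RHS]prod_if_in.
under [RHS]eq_bigr => p _.
  rewrite (_ : (if _ then _ else _) = (p \in q)%:R * f p + 1); last first.
    by case: ifP => _; rewrite ?mul1r ?mul0r ?add0r // addrC.
  over.
rewrite bigA_distr [LHS]big_mkcond /=; apply: eq_bigr => r _.
rewrite prod_if_in; case: ifP => [/subsetP h|/negbT/subsetPn[p pr /negbTE pq]].
  by apply: eq_bigr => p pr; rewrite h // mul1r.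
by rewrite (bigD1 p pr) /= pq !mul0r.
Qed.

End SubsetSums.

Section SelbergWeight.
Variables (R : realFieldType) (T : finType) (v : T -> R) (S : pred {set T}).

Definition snorm (I : {set T}) : R := \prod_(p in I) v p.
Definition sphi (I : {set T}) : R := \prod_(p in I) (v p - 1).
Definition sieve_sum : R := \sum_(q | S q) (sphi q)^-1.
(** Up to sign, the diagonal variables of Selberg's quadratic form at their optimum under lam_1 = 1;
    the weights below arise from them by Moebius inversion. *)
Definition sieve_y (q : {set T}) : R := (S q)%:R / (sphi q * sieve_sum).
Definition sieve_weight (I : {set T}) : R :=
  snorm I * (-1) ^+ #|I| * \sum_(q : {set T} | I \subset q) sieve_y q.

Local Notation G := sieve_sum.
Local Notation y := sieve_y.
Local Notation lam := sieve_weight.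

Hypothesis v_ge2 : forall p, 2 <= v p.
Hypothesis S0 : S set0.
Hypothesis S_down : forall I J : {set T}, I \subset J -> S J -> S I.

Let v_gt0 p : 0 < v p. Proof. by apply: lt_le_trans (v_ge2 p). Qed.
Let v1_gt0 p : 0 < v p - 1. Proof. by have := v_ge2 p; lra. Qed.

Lemma snorm_gt0 I : 0 < snorm I. Proof. by apply: prodr_gt0. Qed.
Lemma sphi_gt0 I : 0 < sphi I. Proof. by apply: prodr_gt0. Qed.

Lemma sieve_sum_ge1 : 1 <= G.
Proof.
rewrite /G (bigD1 set0) //= {1}/sphi big_set0 invr1 lerDl.
by apply: sumr_ge0 => q _; rewrite invr_ge0 ltW ?sphi_gt0.
Qed.

Lemma sieve_sum_gt0 : 0 < G. Proof. exact: lt_le_trans ltr01 sieve_sum_ge1. Qed.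

Lemma sieve_y_ge0 q : 0 <= y q.
Proof. by rewrite divr_ge0 // mulr_ge0 ?ltW ?sphi_gt0 ?sieve_sum_gt0. Qed.

Lemma sieve_weight_out I : ~~ S I -> lam I = 0.
Proof.
move=> nS; rewrite /lam big1 ?mulr0 // => q sIq; rewrite /y.
by case Sq: (S q); rewrite ?mul0r //; rewrite (S_down sIq Sq) in nS.
Qed.

Lemma sieve_weight0 : lam set0 = 1.
Proof.
rewrite /lam /snorm big_set0 cards0 expr0 !mul1r.
rewrite (eq_bigl xpredT) => [|q]; last by rewrite sub0set.
rewrite (eq_bigr (fun q => (if S q then (sphi q)^-1 else 0) / G)).
  by rewrite -mulr_suml -big_mkcond /= divff // gt_eqF ?sieve_sum_gt0.
by move=> q _; rewrite /y invfM mulrA; case: (S q); rewrite ?mul1r // !mul0r.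
Qed.

(* The inner sum after swapping summations: Moebius inversion leaves only [q]
   with [B :|: r \subset q \subset A :|: r]. *)
Lemma norm_sign_sum (A B r q : {set T}) : B \subset A -> [disjoint r & A] ->
  `|\sum_(I : {set T} | [&& I :&: A == B, r \subset I & I \subset q])
      (-1) ^+ #|I| : R| <= ((B :|: r \subset q) && (q \subset A :|: r))%:R.
Proof.
move=> sBA dis.
(* Each prime decides independently whether it lies in I: [F p] is the signed contribution of p in
   I, [H p] that of p outside I. For p in q outside A and r the two cancel. *)
pose F p : R := - ((p \in q) && ((p \in A) ==> (p \in B)))%:R.
pose H p : R := ((p \notin r) && ((p \in A) ==> (p \notin B)))%:R.
have -> : \sum_(I : {set T} | [&& I :&: A == B, r \subset I & I \subset q]) (-1) ^+ #|I|
   = \prod_p (F p + H p).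
  rewrite bigA_distr big_mkcond /=; apply: eq_bigr => I _.
  rewrite (eq_bigr (fun p => (if p \in I then -1 else 1) *
     (if p \in I then (p \in q) && ((p \in A) ==> (p \in B)) else
       (p \notin r) && ((p \in A) ==> (p \notin B)))%:R)); last first.
    by move=> p _; rewrite /F /H; case: (p \in I); rewrite ?mul1r ?mulN1r.
  rewrite big_split /= prod_if_in prodr_const prod_indicator.
  set c1 := [&& _, _ & _]; set c2 := [forall p, _].
  have -> : c1 = c2.
    apply/and3P/forallP => [[/eqP <- /subsetP rI /subsetP Iq] p|h] /=.
      rewrite !inE; case pI: (p \in I) => /=.
        by rewrite (Iq _ pI) /=; case: (p \in A).
      rewrite implybT andbT; apply/negP => /rI; by rewrite pI.
    split.
    - apply/eqP/setP => p; have := h p; rewrite /= !inE.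
      have sB: (p \in B) ==> (p \in A) by apply/implyP/(subsetP sBA).
      by move: sB; case: (p \in I); case: (p \in A); case: (p \in B); rewrite //= andbF.
    - apply/subsetP => p pr; have := h p; rewrite /= pr /=; by case: (p \in I).
    - apply/subsetP => p pI; have := h p; rewrite /= pI; by case/andP.
  by case: c2; rewrite ?mulr1 ?mulr0.
rewrite normr_prod.
pose c p := (((p \in B) || (p \in r)) ==> (p \in q)) &&
            ((p \in q) ==> ((p \in A) || (p \in r))).
apply: (@le_trans _ _ (\prod_p (c p)%:R)).
  apply: ler_prod => p _; rewrite normr_ge0 /=.
  have sB: (p \in B) ==> (p \in A) by apply/implyP/(subsetP sBA).
  have dd: ~~ ((p \in r) && (p \in A)).
    by apply/negP => /andP[pr]; rewrite (disjointFr dis pr).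
  move: sB dd; rewrite /F /H /c.
  case: (p \in A); case: (p \in B); case: (p \in r); case: (p \in q) => //= _ _;
   by rewrite ?(addrN, addr0, add0r, oppr0, addNr, normrN, normr0, normr1).
rewrite prod_indicator ler_nat; case: forallP => //= h.
rewrite [X in (_ <= X)%N](_ : _ = 1%N) //; apply/eqP; rewrite eqb1; apply/andP; split; apply/subsetP => p.
  by rewrite !inE => pp; have /= /andP[/implyP/(_ pp)] := h p.
by move=> pp; rewrite !inE; have /= /andP[_ /implyP/(_ pp)] := h p.
Qed.

(** The linear forms that diagonalise [sieve_form]: I runs over the multiples of r whose part inside
    A is B, and this part is removed from the denominator. *)
Definition sieve_u (A B r : {set T}) : R :=
  \sum_(I : {set T} | (I :&: A == B) && (r \subset I)) lam I / snorm (I :\: A).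

Lemma sieve_uE (A B r : {set T}) : sieve_u A B r = snorm B * \sum_q y q *
   \sum_(I : {set T} | [&& I :&: A == B, r \subset I & I \subset q]) (-1) ^+ #|I|.
Proof.
rewrite /sieve_u; under [in RHS]eq_bigr do rewrite mulr_sumr big_mkcond.
rewrite exchange_big mulr_sumr big_mkcond; apply: eq_bigr => I _.
case: ifP => [/andP[/eqP IA rI]|h]; last first.
  by rewrite big1 ?mulr0 // => q _; rewrite andbA h.
rewrite IA eqxx rI /= /lam /snorm (prod_setID A I) IA -/(snorm _) -/(snorm _).
have n0 : snorm (I :\: A) != 0 by rewrite gt_eqF ?snorm_gt0.
rewrite (_ : _ / _ = snorm B * ((-1) ^+ #|I| * \sum_(q : {set T} | I \subset q) y q)).
  rewrite mulr_sumr big_mkcond; congr (_ * _); apply: eq_bigr => q _.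
  by case: ifP; rewrite ?mulr0 // mulrC.
by field.
Qed.

(** Only q between B :|: r and A :|: r survive, and the sum over these q factors over primes. A
    prime of B costs v/(v-1), a prime of A outside B costs 1 + 1/(v-1); these are equal, and at most
    2 because v >= 2. *)
Lemma norm_sieve_u (A B r : {set T}) : B \subset A -> [disjoint r & A] ->
  `|sieve_u A B r| <= 2 ^+ #|A| * y r.
Proof.
move=> sBA dis.
rewrite sieve_uE normrM (gtr0_norm (snorm_gt0 _)).
apply: (@le_trans _ _ (snorm B * \sum_q y q * ((B :|: r \subset q) && (q \subset A :|: r))%:R)).
  rewrite ler_pM2l ?snorm_gt0 //; apply: le_trans (ler_norm_sum _ _ _) _.
  apply: ler_sum => q _; rewrite normrM (ger0_norm (sieve_y_ge0 q)).
  by apply: ler_wpM2l; rewrite ?sieve_y_ge0 ?norm_sign_sum.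
pose F p : R := (p \in A :|: r)%:R / (v p - 1).
pose H p : R := (p \notin B :|: r)%:R.
apply: (@le_trans _ _ (snorm B * ((S r)%:R / G * \prod_p (F p + H p)))).
  rewrite ler_pM2l ?snorm_gt0 // bigA_distr mulr_sumr; apply: ler_sum => q _.
  have -> : \prod_p (if p \in q then F p else H p) =
     (sphi q)^-1 * ((B :|: r \subset q) && (q \subset A :|: r))%:R.
    rewrite (eq_bigr (fun p => (if p \in q then (v p - 1)^-1 else 1) *
       (if p \in q then p \in A :|: r else p \notin B :|: r)%:R)); last first.
      by move=> p _; rewrite /F /H; case: (p \in q); rewrite ?mul1r // mulrC.
    rewrite big_split /= prod_if_in prod_indicator /sphi prodfV; congr (_ * _%:R).
    congr nat_of_bool; apply/forallP/andP => [h|[/subsetP h1 /subsetP h2] p] /=.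
      split; apply/subsetP => p pp; have := h p => /=; last by rewrite pp.
      by rewrite pp /=; case: (p \in q).
    by case: ifP => [/h2 //|/negbT]; apply: contra => /h1.
  case: andP => [[sBq _]|_]; rewrite ?mulr0 // !mulr1 /y invfM mulrA mulrAC.
  apply: ler_wpM2r; first by rewrite invr_ge0 ltW ?sphi_gt0.
  apply: ler_wpM2r; first by rewrite invr_ge0 ltW ?sieve_sum_gt0.
  rewrite ler_nat; case Sq: (S q) => //.
  by rewrite (S_down _ Sq) //; apply: subset_trans sBq; apply: subsetUr.
have -> : 2 ^+ #|A| * y r = (S r)%:R / G * (2 ^+ #|A| * (sphi r)^-1).
  by rewrite /y invfM; ring.
rewrite mulrCA; apply: ler_wpM2l; first by rewrite divr_ge0 // ltW ?sieve_sum_gt0.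
rewrite /snorm /sphi -prodfV -prodr_const -!prod_if_in -!big_split /=.
apply: ler_prod => p _; rewrite /F /H !inE.
have sB: (p \in B) ==> (p \in A) by apply/implyP/(subsetP sBA).
have dd: ~~ ((p \in r) && (p \in A)).
  by apply/negP => /andP[pr]; rewrite (disjointFr dis pr).
have i0 : 0 <= (v p - 1)^-1 by rewrite invr_ge0 ltW.
have n1 : v p - 1 != 0 by rewrite gt_eqF.
have i1 : v p * (v p - 1)^-1 = 1 + (v p - 1)^-1.
  by rewrite -{1}(subrK 1 (v p)) mulrDl divff // mul1r.
have i2 : (v p - 1)^-1 <= 1 by rewrite invf_le1 //; have := v_ge2 p; lra.
move: sB dd; case: (p \in A); case: (p \in B); case: (p \in r) => //= _ _;
  rewrite ?(mul1r, mulr1, mul0r, addr0, add0r) ?i1; apply/andP; split; lra.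
Qed.

Definition sieve_form (A B1 B2 : {set T}) : R :=
  \sum_(I : {set T} | I :&: A == B1) \sum_(J : {set T} | J :&: A == B2)
    lam I * lam J / snorm ((I :|: J) :\: A).

(* Selberg's diagonalisation: [1 / [d, d'] = \sum_(r | (d, d')) phi r / (d d')]. *)
Lemma sieve_formE A B1 B2 : sieve_form A B1 B2 =
  \sum_(r : {set T} | [disjoint r & A]) sphi r * sieve_u A B1 r * sieve_u A B2 r.
Proof.
have key I J : (snorm ((I :|: J) :\: A))^-1 =
   \sum_(r : {set T} | [disjoint r & A])
     sphi r * ((r \subset I)%:R / snorm (I :\: A)) * ((r \subset J)%:R / snorm (J :\: A)).
  have := prod_setUI (I :\: A) (J :\: A) v; rewrite -setDUl -!/(snorm _) => e.
  have nz K : snorm K != 0 by rewrite gt_eqF ?snorm_gt0.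
  have -> : (snorm ((I :|: J) :\: A))^-1 =
      snorm ((I :\: A) :&: (J :\: A)) * ((snorm (I :\: A))^-1 * (snorm (J :\: A))^-1).
    rewrite -invfM -e invfM mulrCA mulfV ?mulr1 //.
  have -> : snorm ((I :\: A) :&: (J :\: A)) =
      \sum_(r : {set T} | r \subset (I :\: A) :&: (J :\: A)) sphi r.
    by rewrite sum_subset_prod; apply: eq_bigr => p _; rewrite addrC subrK.
  rewrite mulr_suml [LHS]big_mkcond [RHS]big_mkcond; apply: eq_bigr => r _.
  rewrite subsetI !subsetD.
  case: [disjoint r & A] => /=; case: (r \subset I); case: (r \subset J);
    by rewrite ?(andbT, andbF) /=; ring.
rewrite /sieve_form.
under eq_bigr do under eq_bigr do rewrite key mulr_sumr.
under eq_bigr do rewrite exchange_big.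
rewrite exchange_big; apply: eq_bigr => r _.
rewrite /sieve_u -mulrA mulr_suml mulr_sumr.
rewrite [LHS]big_mkcond [RHS]big_mkcond; apply: eq_bigr => I _.
case: (I :&: A == B1) => //=.
case: (r \subset I) => /=; last by rewrite big1 // => J _; ring.
rewrite !mulr_sumr [LHS]big_mkcond [RHS]big_mkcond; apply: eq_bigr => J _.
case: (J :&: A == B2) => //=.
by case: (r \subset J) => /=; ring.
Qed.

(** In the diagonal form two factors [y r] meet one [sphi r], leaving 1 / (sphi r * G^2); summing
    over the r with S r restores one G, so the saving 1/G survives. *)
Lemma norm_sieve_form (A B1 B2 : {set T}) : B1 \subset A -> B2 \subset A ->
  `|sieve_form A B1 B2| <= 4 ^+ #|A| / G.
Proof.
move=> s1 s2; rewrite sieve_formE; apply: le_trans (ler_norm_sum _ _ _) _.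
have -> : 4 ^+ #|A| / G = \sum_(r | S r) 4 ^+ #|A| * (sphi r)^-1 / (G * G).
  rewrite -mulr_suml -mulr_sumr -/G invfM !mulrA mulfK //.
  by rewrite gt_eqF ?sieve_sum_gt0.
rewrite [leLHS]big_mkcond [leRHS]big_mkcond; apply: ler_sum => r _.
have h0 : 0 <= (sphi r)^-1 / (G * G).
  by rewrite divr_ge0 ?invr_ge0 ?mulr_ge0 ?ltW ?sphi_gt0 ?sieve_sum_gt0.
case: ifP => dis; last by case: (S r); rewrite // -mulrA mulr_ge0 // exprn_ge0.
have u1 := norm_sieve_u s1 dis; have u2 := norm_sieve_u s2 dis.
rewrite !normrM (gtr0_norm (sphi_gt0 _)) -mulrA.
apply: (@le_trans _ _ (sphi r * ((2 ^+ #|A| * y r) * (2 ^+ #|A| * y r)))).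
  by apply: ler_wpM2l; [rewrite ltW ?sphi_gt0 | apply: ler_pM].
rewrite /y (_ : 4 ^+ #|A| = 2 ^+ #|A| * 2 ^+ #|A| :> R); last first.
  by rewrite -exprMn; congr (_ ^+ _); ring.
case: (S r) => /=; last by rewrite !(mul0r, mulr0).
rewrite le_eqVlt; apply/orP; left; apply/eqP; field.
by rewrite !gt_eqF ?sphi_gt0 ?sieve_sum_gt0.
Qed.

(** With A empty the sign sum leaves only q = r, so [sieve_u] is [y r] up to sign and nothing is
    lost. *)
Lemma sieve_form0 : sieve_form set0 set0 set0 = G^-1.
Proof.
have u0 r : sieve_u set0 set0 r = (-1) ^+ #|r| * y r.
  rewrite sieve_uE (bigD1 r) //= [X in _ + X]big1 => [|q qr]; last first.
    have d0 : [disjoint r & set0] by rewrite -setI_eq0 setI0.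
    have := norm_sign_sum q (sub0set _) d0.
    by rewrite !set0U -eqEsubset eq_sym (negbTE qr) normr_le0 => /eqP ->; rewrite mulr0.
  rewrite {1}/snorm big_set0 mul1r addr0 mulrC; congr (_ * _).
  rewrite (bigD1 r) /=; last by rewrite setI0 eqxx subxx.
  rewrite big1 ?addr0 // => I /andP[/and3P[_ rI Ir]] /negP[].
  by rewrite eqEsubset Ir.
rewrite sieve_formE /=.
have -> : G^-1 = \sum_(r | S r) (sphi r)^-1 / (G * G).
  by rewrite -mulr_suml -/G invfM mulrA mulfV ?mul1r ?gt_eqF ?sieve_sum_gt0.
rewrite [LHS]big_mkcond [RHS]big_mkcond; apply: eq_bigr => r _.
have -> : [disjoint r & set0] by rewrite -setI_eq0 setI0.
rewrite !u0 -mulrA mulrACA -expr2 sqrr_sign mul1r /y.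
case: (S r) => /=; last by rewrite !(mul0r, mulr0).
by field; rewrite !gt_eqF ?sphi_gt0 ?sieve_sum_gt0.
Qed.

Lemma norm_sieve_weight I : `|lam I| <= 2 ^+ #|I|.
Proof.
rewrite /lam !normrM (gtr0_norm (snorm_gt0 _)) normrX normrN1 expr1n mulr1.
rewrite ger0_norm; last by apply: sumr_ge0 => q _; apply: sieve_y_ge0.
apply: (@le_trans _ _ (snorm I * (sphi I)^-1)).
  rewrite ler_pM2l ?snorm_gt0 //.
  have -> : (sphi I)^-1 = \sum_(q | S q) (sphi q)^-1 * (sphi I * G)^-1.
    by rewrite -mulr_suml -/G; field; rewrite !gt_eqF ?sphi_gt0 ?sieve_sum_gt0.
  (* A superset q of I corresponds to q :\: I: [sphi] splits off the factor [sphi I] and S is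
     inherited, so the sum is majorised by the one defining G. *)
  rewrite (reindex_onto (fun q => q :|: I) (fun q => q :\: I)); last first.
    by move=> q sIq; apply/setP => p; rewrite !inE orbC; have := subsetP sIq p; case: (p \in I) => //= ->.
  rewrite [leLHS]big_mkcond [leRHS]big_mkcond; apply: ler_sum => q _.
  have h0 : 0 <= (sphi q)^-1 * (sphi I * G)^-1.
    by rewrite ltW // mulr_gt0 ?invr_gt0 ?mulr_gt0 ?sphi_gt0 ?sieve_sum_gt0.
  case: ifP => [/andP[_ /eqP qI]|_]; last by case: ifP.
  rewrite /y; case SqI: (S (q :|: I)); last by rewrite mul0r; case: ifP.
  rewrite (S_down _ SqI) ?subsetUl // mul1r.
  have := prod_setUI q I (fun p => v p - 1); rewrite -!/(sphi _).
  have -> : q :&: I = set0.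
    by apply/setP => p; rewrite -qI !inE; case: (p \in I); rewrite // andbF.
  rewrite [sphi set0]/sphi big_set0 mulr1 => ->.
  by rewrite !invfM mulrA.
rewrite /snorm /sphi -prodfV -prodr_const -big_split /=.
apply: ler_prod => p _; have := v_ge2 p; have := v1_gt0 p => h1 h2.
by rewrite divr_ge0 ?(ltW h1) ?(ltW (v_gt0 p)) // ler_pdivrMr //; lra.
Qed.

(** * Expansion of the sieve sum around independent divisibilities *)

Section Main.
Variables (m : nat) (rho : T -> {set 'I_m} -> R) (d : T -> R).
Hypothesis rho_close : forall p Q, `|rho p Q - (v p) ^- #|Q| | <= d p.

Local Notation family := {ffun 'I_m -> {set T} * {set T}}.

Definition fam_weight (X : family) : R := \prod_i (lam (X i).1 * lam (X i).2).
Definition fam_supp (X : family) (p : T) : {set 'I_m} :=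
  [set i | p \in (X i).1 :|: (X i).2].
Definition sieve_main : R := \sum_X fam_weight X * \prod_p rho p (fam_supp X p).

Let cut (A : {set T}) (IJ : {set T} * {set T}) := (IJ.1 :&: A, IJ.2 :&: A).
Let e p Q := rho p Q - (v p) ^- #|Q|.

(** Write each density as its discrepancy [e] plus the independent value, let A be the set of primes
    where [e] is chosen, and group the families by their trace Y on A. The discrepancies see only Y,
    and the rest splits over i into quadratic forms. *)
Lemma sieve_main_expand : sieve_main =
  \sum_(A : {set T}) \sum_(Y : family) (\prod_(p in A) e p (fam_supp Y p)) *
     \prod_i sieve_form A (Y i).1 (Y i).2.
Proof.
rewrite /sieve_main.
under eq_bigr => X _.
  rewrite (eq_bigr (fun p => e p (fam_supp X p) + (v p) ^- #|fam_supp X p|)); last first.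
    by move=> p _; rewrite /e subrK.
  rewrite bigA_distr mulr_sumr.
  over.
rewrite exchange_big; apply: eq_bigr => A _.
rewrite (partition_big (fun X : family => [ffun i => cut A (X i)]) xpredT) //=.
apply: eq_bigr => Y _.
pose F (IJ : {set T} * {set T}) : R := lam IJ.1 * lam IJ.2 / snorm ((IJ.1 :|: IJ.2) :\: A).
have -> : \prod_i sieve_form A (Y i).1 (Y i).2 = \prod_i \sum_(IJ | cut A IJ == Y i) F IJ.
  apply: eq_bigr => i _; rewrite /sieve_form pair_big /=; apply: eq_bigl => IJ.
  by rewrite /cut [Y i]surjective_pairing xpair_eqE.
rewrite bigA_distr_big_dep mulr_sumr; apply: eq_big => X.
  apply/eqP/familyP => [<- i|h]; first by apply/eqP; rewrite ffunE.
  by apply/ffunP => i; rewrite ffunE; apply/eqP; apply: h.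
move=> /eqP XY.
have eA p : p \in A -> fam_supp X p = fam_supp Y p.
  by move=> pA; apply/setP => i; rewrite -XY !inE !ffunE /= !inE pA !andbT.
rewrite (eq_bigr (fun p => (if p \in A then e p (fam_supp Y p) else 1) *
   \prod_i (if p \in ((X i).1 :|: (X i).2) :\: A then (v p)^-1 else 1))); last first.
  move=> p _; case: ifP => pA.
    by rewrite eA // big1 ?mulr1 // => i _; rewrite inE pA.
  rewrite mul1r -exprVn -prodr_const big_mkcond; apply: eq_bigr => i _.
  by rewrite !inE pA.
rewrite big_split /= prod_if_in mulrCA; congr (_ * _).
rewrite exchange_big -big_split; apply: eq_bigr => i _ /=.
by rewrite prod_if_in /F /snorm prodfV.
Qed.

(** Each of the two traces has 2^|A| possible values, whence 16 = 2 * 2 * 4. *)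
Lemma sum_norm_sieve_form (A : {set T}) :
  \sum_(B : {set T} * {set T}) `|sieve_form A B.1 B.2| <= 16 ^+ #|A| / G.
Proof.
apply: (@le_trans _ _ (\sum_(B : {set T} * {set T})
    (B.1 \subset A)%:R * ((B.2 \subset A)%:R * (4 ^+ #|A| / G)))).
  apply: ler_sum => -[B1 B2] _ /=.
  have out (B : {set T}) : ~~ (B \subset A) -> forall I, (I :&: A == B) = false.
    move=> h I; apply/negbTE; apply: contra h => /eqP <-; exact: subsetIr.
  case s1: (B1 \subset A); last first.
    by rewrite mul0r normr_le0 /sieve_form big1 // => I; rewrite out ?s1.
  case s2: (B2 \subset A); last first.
    rewrite mul0r mulr0 normr_le0 /sieve_form big1 // => I _.
    by rewrite big1 // => J; rewrite out ?s2.
  by rewrite !mul1r norm_sieve_form.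
rewrite -(pair_bigA _ (fun B1 B2 : {set T} => (B1 \subset A)%:R * ((B2 \subset A)%:R * (4 ^+ #|A| / G)))) /=.
under eq_bigr do rewrite -mulr_sumr -mulr_suml.
rewrite -mulr_suml.
have -> : \sum_(B : {set T}) (B \subset A)%:R = 2 ^+ #|A| :> R.
  rewrite -natr_sum -natrX -card_powerset -sum1_card; congr _%:R.
  rewrite [RHS]big_mkcond; apply: eq_bigr => B _.
  by rewrite powersetE; case: (B \subset A).
rewrite !mulrA -!exprMn le_eqVlt; apply/orP; left; apply/eqP; congr (_ ^+ _ / _); ring.
Qed.

(** The empty A contributes exactly G^-m. Any other A contributes at most G^-m times the product of
    16^m * d p over A, and these products sum to the Euler product minus its leading 1. *)
Theorem sieve_main_asymp :
  `|G ^+ m * sieve_main - 1| <= \prod_p (1 + 16 ^+ m * d p) - 1.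
Proof.
have d_ge0 p : 0 <= d p by apply: le_trans (rho_close p set0).
have G0 := sieve_sum_gt0.
have -> : \prod_p (1 + 16 ^+ m * d p) - 1 =
    \sum_(A : {set T} | A != set0) \prod_(p in A) (16 ^+ m * d p).
  have := sum_subset_prod setT (fun p => 16 ^+ m * d p).
  have -> : \sum_(A : {set T} | A \subset setT) \prod_(p in A) (16 ^+ m * d p) =
      \sum_(A : {set T}) \prod_(p in A) (16 ^+ m * d p).
    by apply: eq_bigl => A; rewrite subsetT.
  have -> : \prod_(p in setT) (1 + 16 ^+ m * d p) = \prod_p (1 + 16 ^+ m * d p).
    by apply: eq_bigl => p; rewrite in_setT.
  by move=> <-; rewrite (bigD1 set0) //= big_set0 addrAC subrr add0r.
rewrite sieve_main_expand (bigD1 set0) //=.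
have -> : \sum_(Y : family) (\prod_(p in set0) e p (fam_supp Y p)) *
     \prod_i sieve_form set0 (Y i).1 (Y i).2 = G ^- m.
  under eq_bigr do rewrite big_set0 mul1r.
  rewrite -(bigA_distr_bigA (fun i (B : {set T} * {set T}) => sieve_form set0 B.1 B.2)).
  rewrite prodr_const card_ord -exprVn; congr (_ ^+ _).
  rewrite (bigD1 (set0, set0)) //= sieve_form0 big1 ?addr0 // => -[B1 B2].
  rewrite xpair_eqE negb_and => h; rewrite /sieve_form /= big1 // => I /eqP; rewrite setI0 => B10.
  rewrite big1 // => J /eqP; rewrite setI0 => B20.
  by move: h; rewrite -B10 -B20 !eqxx.
rewrite mulrDr mulfV ?expf_neq0 ?gt_eqF // addrAC subrr add0r mulr_sumr.
apply: le_trans (ler_norm_sum _ _ _) _; apply: ler_sum => A _.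
rewrite normrM normrX (gtr0_norm G0).
apply: (@le_trans _ _ (G ^+ m * (\prod_(p in A) d p * (16 ^+ #|A| / G) ^+ m))).
  rewrite ler_pM2l ?exprn_gt0 //; apply: le_trans (ler_norm_sum _ _ _) _.
  apply: (@le_trans _ _ (\sum_(Y : family) (\prod_(p in A) d p) *
     \prod_i `|sieve_form A (Y i).1 (Y i).2|)).
    apply: ler_sum => Y _; rewrite normrM !normr_prod ler_wpM2r //.
      by apply: prodr_ge0.
    by apply: ler_prod => p _; rewrite normr_ge0 /= rho_close.
  rewrite -mulr_sumr ler_wpM2l //; first by apply: prodr_ge0.
  rewrite -(bigA_distr_bigA (fun i (B : {set T} * {set T}) => `|sieve_form A B.1 B.2|)).
  rewrite prodr_const card_ord lerXn2r ?nnegrE ?sumr_ge0 ?sum_norm_sieve_form //.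
  by rewrite divr_ge0 ?exprn_ge0 ?ltW.
rewrite big_split /= prodr_const expr_div_n -!exprM mulnC.
rewrite le_eqVlt; apply/orP; left; apply/eqP; field.
by rewrite expf_neq0 ?gt_eqF.
Qed.

End Main.

End SelbergWeight.

(** * Counting modulo primes *)

Lemma card_linear_fiber (F : finFieldType) (t r : nat) (A : 'M[F]_(t, r)) (c : 'rV_r) :
  row_full A -> (#|[set x : 'rV_t | x *m A == c]| * #|F| ^ r = #|F| ^ t)%N.
Proof.
move=> fA.
have fib c' : #|[set x : 'rV_t | x *m A == c']| = #|[set x : 'rV_t | x *m A == c]|.
  pose w := (c - c') *m pinvmx A.
  have wA : w *m A = c - c' by rewrite /w mulmxKpV // submx_full.
  rewrite -(card_imset _ (@addrI _ w)); apply: eq_card => x; rewrite !inE.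
  apply/imsetP/eqP => [[x' + ->]|xA].
    by rewrite inE => /eqP xA; rewrite mulmxDl xA wA subrK.
  exists (x - w); last by rewrite addrC subrK.
  by rewrite inE mulmxBl xA wA opprB addrC subrK.
have <- : #|{: 'rV[F]_t}| = (#|F| ^ t)%N by rewrite card_mx mul1n.
rewrite -[LHS]mulnC -{1}[r]mul1n -card_mx -sum_nat_const -[RHS]sum1_card.
rewrite (partition_big (mulmxr A) xpredT) //=; apply: eq_big => // c' _.

by rewrite -(fib c') -sum1_card; apply: eq_bigl => x; rewrite inE.
Qed.

(** Residue vectors modulo different primes live in different types; coding them in one common box
    lets [bigA_distr_big_dep] turn a product over p of sums into a sum over systems of residues. *)
Lemma sum_Fp_box (V : nmodType) (p n t : nat) (f : 'rV['F_p]_t -> V) : prime p -> (p <= n)%N ->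
  \sum_(x : 'rV['F_p]_t) f x =
  \sum_(g : {ffun 'I_t -> 'I_n} | [forall j, (g j < p)%N]) f (\row_j (g j)%:R).
Proof.
move=> pp pn; have n0 : (0 < n)%N by apply: leq_trans pn; apply: prime_gt0.
pose h (x : 'rV['F_p]_t) : {ffun 'I_t -> 'I_n} := [ffun j => insubd (Ordinal n0) (x 0 j : nat)].
have ltp (x : 'F_p) : (x < p)%N by rewrite -[X in (_ < X)%N](Fp_cast pp) ltn_ord.
rewrite (reindex_onto (fun g : {ffun 'I_t -> 'I_n} => \row_j (g j)%:R) h); last first.
  move=> x _; apply/rowP => j; rewrite mxE ffunE val_insubd (leq_trans (ltp _) pn).
  by rewrite natr_Zp.
apply: eq_bigl => g /=; apply/eqP/forallP => [<- j|gp].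
  by rewrite ffunE val_insubd (leq_trans (ltp _) pn) ltp.
apply/ffunP => j; apply: val_inj; rewrite ffunE val_insubd (leq_trans (ltp _) pn).
by rewrite mxE val_Fp_nat // modn_small.
Qed.

Lemma val_addFp_int (N : nat) (x : 'F_N) (a : int) : prime N ->
  0 <= (x : nat)%:Z + a < N%:Z ->
  (nat_of_ord (x + a%:~R)%R)%:Z = (x : nat)%:Z + a.
Proof.
move=> pN; case e: (_ + a) => [n|n] // /andP[_ ltn].
have -> : x + a%:~R = n%:R by rewrite -{1}(natr_Zp x) !pmulrn -intrD e.
by rewrite val_Fp_nat // modn_small.
Qed.

Lemma crt_exists (T : eqType) (s : seq T) (v : T -> nat) (f : T -> nat) :
  uniq s -> (forall p, p \in s -> 0 < v p)%N ->
  (forall p q, p \in s -> q \in s -> p != q -> coprime (v p) (v q)) ->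
  exists2 n, (n < \prod_(p <- s) v p)%N & forall p, p \in s -> n = f p %[mod v p].
Proof.
move=> us v0 cop.
suff [n nP] : exists n, forall p, p \in s -> n = f p %[mod v p].
  exists (n %% \prod_(p <- s) v p)%N.
    by rewrite ltn_mod big_seq prodn_cond_gt0.
  move=> p ps; rewrite -nP // modn_dvdm //.
  by rewrite (big_rem p) //= dvdn_mulr.
elim: s us v0 cop => [|p s IH] /=; first by exists 0%N.
case/andP => ps us v0 cop.
have [q qs|q r qs rs|n nP] := IH us.
- by apply: v0; rewrite inE qs orbT.
- by apply: cop; rewrite ?inE ?qs ?rs ?orbT.
have cp : coprime (v p) (\prod_(q <- s) v q)%N.
  rewrite big_seq; elim/big_ind: _ => [|a b ca cb|q qs]; rewrite ?coprimen1 //.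
    by rewrite coprimeMr ca.
  apply: cop; rewrite ?inE ?eqxx ?qs ?orbT //.
  by apply: contraNneq ps => ->.
exists (chinese (v p) (\prod_(q <- s) v q) (f p) n) => q.
rewrite inE => /orP[/eqP ->|qs]; first by rewrite chinese_modl.
rewrite -nP // -[in RHS](modn_dvdm (m := (\prod_(q <- s) v q)%N)); last first.
  by rewrite (big_rem q) //= dvdn_mulr.
by rewrite -(chinese_modr cp (f p) n) modn_dvdm // (big_rem q) //= dvdn_mulr.
Qed.

(** * The sieve weight *)

Definition sieve_prime (y z : nat) := {p : 'I_z.+1 | prime p && (y < p)%N}.

Section SievePrimes.
Variables (y z : nat).
Local Notation T := (sieve_prime y z).

Definition spval (p : T) : nat := val (val p).

Lemma spval_prime p : prime (spval p). Proof. by have /andP[] := valP p. Qed.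
Lemma spval_gt p : (y < spval p)%N. Proof. by have /andP[] := valP p. Qed.
Lemma spval_le p : (spval p <= z)%N. Proof. by rewrite -ltnS ltn_ord. Qed.
Lemma spval_inj : injective spval. Proof. by move=> p q /val_inj /val_inj. Qed.

Lemma coprime_spval p q : p != q -> coprime (spval p) (spval q).
Proof.
by move=> pq; rewrite prime_coprime ?spval_prime // dvdn_prime2 ?spval_prime.
Qed.

Definition sprod (I : {set T}) : nat := (\prod_(p in I) spval p)%N.
Definition slevel (I : {set T}) : bool := (sprod I <= z)%N.

Lemma sprod_gt0 I : (0 < sprod I)%N.
Proof. by apply: prodn_cond_gt0 => p _; rewrite prime_gt0 ?spval_prime. Qed.

Lemma dvdn_sprod (I : {set T}) p : (spval p %| sprod I)%N = (p \in I).
Proof.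
apply/idP/idP => [|pI]; last by rewrite /sprod (bigD1 p) //= dvdn_mulr.
apply: contraTT => pI; rewrite -prime_coprime ?spval_prime // /sprod.
elim/big_ind: _ => [|a b ca cb|q qI]; rewrite ?coprimen1 ?coprimeMr ?ca //.
by apply: coprime_spval; apply: contraNneq pI => ->.
Qed.

Lemma sprod_inj : injective sprod.
Proof. by move=> I J e; apply/setP => p; rewrite -!dvdn_sprod e. Qed.

Lemma sprod_dvd (I : {set T}) a :
  (sprod I %| a)%N = (I \subset [set p | spval p %| a])%N.
Proof.
apply/idP/subsetP => [Ia p pI|h]; first by rewrite inE (dvdn_trans _ Ia) ?dvdn_sprod.
rewrite /sprod -big_enum /=.
have {h}: {in enum I, forall p, spval p %| a}%N.
  by move=> p; rewrite mem_enum => /h; rewrite inE.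
elim: (enum I) (enum_uniq I) => [|p s IH] /=; first by rewrite big_nil.
case/andP => ps us h; rewrite big_cons Gauss_dvd.
  by rewrite h ?mem_head // IH // => q qs; rewrite h // inE qs orbT.
rewrite big_seq; elim/big_ind: _ => [|b c cb cc|q qs]; rewrite ?coprimen1 ?coprimeMr ?cb //.
by apply: coprime_spval; apply: contraNneq ps => ->.
Qed.

Lemma slevel0 : (0 < z)%N -> slevel set0.
Proof. by rewrite /slevel /sprod big_set0. Qed.

Lemma sprodS (I J : {set T}) : I \subset J -> (sprod I %| sprod J)%N.
Proof.
move=> sIJ; rewrite sprod_dvd; apply/subsetP => p pI.
by rewrite inE dvdn_sprod (subsetP sIJ).
Qed.

Lemma slevelS (I J : {set T}) : I \subset J -> slevel J -> slevel I.
Proof.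
by move=> sIJ; apply: leq_trans; apply: dvdn_leq; rewrite ?sprod_gt0 ?sprodS.
Qed.

Lemma exp2_card_le_sprod (I : {set T}) : (2 ^ #|I| <= sprod I)%N.
Proof. by rewrite -prod_nat_const; apply: leq_prod => p _; rewrite prime_gt1 ?spval_prime. Qed.

Lemma card_slevel : (#|[pred I | slevel I]| <= z.+1)%N.
Proof.
have f_inj : {in [pred I | slevel I] &, injective (fun I => inord (sprod I) : 'I_z.+1)}.
  by move=> I J; rewrite !inE => sI sJ /(congr1 val); rewrite /= !inordK // => /sprod_inj.
by rewrite -(card_in_image f_inj) -[X in (_ <= X)%N]card_ord max_card.
Qed.

Variable R : realType.

Definition spvalR (p : T) : R := (spval p)%:R.
Definition selberg_sum : R := sieve_sum spvalR slevel.
Definition selberg_weight : {set T} -> R := sieve_weight spvalR slevel.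
Definition selberg_nu (W n : nat) : R :=
  selberg_sum * (\sum_(I : {set T} | I \subset [set p | spval p %| W * n + 1]%N)
     selberg_weight I) ^+ 2.

Hypothesis z0 : (0 < z)%N.
Local Notation lam := selberg_weight.
Local Notation G := selberg_sum.

Lemma spvalR_ge2 p : 2 <= spvalR p.
Proof. by rewrite ler_nat prime_gt1 ?spval_prime. Qed.
Hint Resolve spvalR_ge2 slevel0 slevelS : core.

Lemma selberg_sum_gt0 : 0 < G.
Proof. by apply: sieve_sum_gt0 => //; apply: slevel0. Qed.

Lemma selberg_nu_ge0 W n : 0 <= selberg_nu W n.
Proof. by rewrite mulr_ge0 ?sqr_ge0 ?ltW ?selberg_sum_gt0. Qed.

Lemma selberg_sum_le : G <= z.+1%:R.
Proof.
apply: (@le_trans _ _ (\sum_(I | slevel I) 1)).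
  apply: ler_sum => I _; rewrite invf_le1 ?sphi_gt0 //.
  rewrite /sphi; elim/big_ind: _ => // [a b a1 b1|p _]; first exact: mulr_ege1.
  by have := spvalR_ge2 p; lra.
rewrite sumr_const ler_nat; apply: leq_trans card_slevel; exact: eq_leq.
Qed.

Lemma selberg_weight_out I : ~~ slevel I -> lam I = 0.
Proof. by apply: sieve_weight_out; apply: slevelS. Qed.

Lemma norm_selberg_weight (I : {set T}) : `|lam I| <= z.+1%:R.
Proof.
case SI: (slevel I); last by rewrite selberg_weight_out ?normr0 ?SI.
apply: le_trans (norm_sieve_weight spvalR_ge2 (slevel0 z0) slevelS I) _.
by rewrite -natrX ler_nat ltnW // ltnS; apply: leq_trans SI; apply: exp2_card_le_sprod.
Qed.

Lemma sum_norm_selberg_weight : \sum_I `|lam I| <= z.+1%:R ^+ 2.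
Proof.
rewrite (bigID slevel) /= [X in _ + X]big1 ?addr0 => [|I nS]; last first.
  by rewrite selberg_weight_out ?normr0.
apply: (@le_trans _ _ (\sum_(I | slevel I) z.+1%:R)).
  by apply: ler_sum => I _; apply: norm_selberg_weight.
rewrite sumr_const -[leLHS]mulr_natr expr2; apply: ler_wpM2l; rewrite ?ler0n // ler_nat.
by apply: leq_trans card_slevel; exact: eq_leq.
Qed.

End SievePrimes.

(** * Averages over Z_N *)

Lemma natr_Fp_eq0 (p n : nat) : prime p -> ((n%:R : 'F_p) == 0) = (p %| n)%N.
Proof. by move=> pp; rewrite (dvdn_pcharf (pchar_Fp pp)). Qed.

Lemma sum_const_indicator (R : realType) (X : finType) (b : pred X) :
  \sum_x (b x)%:R = #|b|%:R :> R.
Proof.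
by rewrite -natr_sum -sum1_card [X in _ = X%:R]big_mkcond; congr _%:R.
Qed.

Section LocalDensity.
Variables (R : realType) (W m t : nat) (A : 'M[int]_(m, t)).

(* [c] is the base point: the forms are [c i + sum_j A i j * x j]. *)
Definition root_cond (p : nat) (c : 'I_m -> nat) (i : 'I_m) (x : 'rV['F_p]_t) : bool :=
  W%:R * ((c i)%:R + \sum_j (A i j)%:~R * x 0 j) + 1 == 0.

Definition local_density (p : nat) (c : 'I_m -> nat) (Q : {set 'I_m}) : R :=
  expect (fun x : 'rV['F_p]_t => [forall (i | i \in Q), root_cond c i x]%:R).

End LocalDensity.

(** * Averages of the sieve weight along an abstract family of forms on a finite set *)

Section Core.
Variables (R : realType) (y z N W m t B : nat) (A : 'M[int]_(m, t)).
Variables (X : finType) (psi : 'I_m -> X -> 'F_N).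
Hypothesis pN : prime N.
Hypothesis A_le : forall i j, `|A i j| <= B%:Z.
(** Covers both applications: affine forms on Z_N^t and translates on Z_N. The matrix A must be
    integral, so that a shift of the forms is an integer that can be reduced modulo p. *)
Hypothesis psi_shift : forall h : 'I_t -> nat, exists2 s : X -> X, injective s &
  forall i x, psi i (s x) = psi i x + (\sum_j A i j * (h j)%:Z)%:~R.
Local Notation T := (sieve_prime y z).

(** The points where a shift of size at most M might carry some form across 0 or N and so change the
    integer representative by a multiple of N. *)
Definition wrap_set (M : nat) : {set X} :=
  [set x | [exists i, ~~ ((M <= psi i x) && (psi i x + M < N))%N]].

Definition base (x : X) (i : 'I_m) : nat := psi i x.

(** Translating X by an integer vector h leaves the sum unchanged and, off [wrap_set], turns the
    condition at p into a root condition on h modulo p. Averaging over all systems f of residues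
    factors over p into local densities; each f costs at most the size of [wrap_set]. *)
Lemma shift_average (Q : T -> {set 'I_m}) (M : nat) :
  (t * B * sprod [set p | Q p != set0] <= M)%N ->
  `|\sum_x [forall p, [forall (i | i \in Q p), (spval p %| W * psi i x + 1)%N]]%:R -
    \sum_x \prod_p local_density R W A (spval p) (base x) (Q p)| <= #|wrap_set M|%:R.
Proof.
move=> MP; set U := [set p | _] in MP.
pose C x := [forall p, [forall (i | i \in Q p), (spval p %| W * psi i x + 1)%N]].
pose Box (p : T) (g : {ffun 'I_t -> 'I_z.+1}) := [forall j, (g j < spval p)%N].
pose row (p : T) (g : {ffun 'I_t -> 'I_z.+1}) : 'rV['F_(spval p)]_t := \row_j (g j)%:R.
pose b x (p : T) (g : {ffun 'I_t -> 'I_z.+1}) :=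
  [forall (i | i \in Q p), root_cond W A (base x) i (row p g)].
pose K : R := \sum_(f in family Box) 1.
have KE : K = \prod_(p : T) #|{: 'rV['F_(spval p)]_t}|%:R.
  transitivity (\sum_(f in family Box) \prod_(p : T) (1 : R)).
    by apply: eq_bigr => f _; rewrite big1_eq.
  rewrite -(bigA_distr_big_dep Box (fun _ _ => 1)); apply: eq_bigr => p _.
  rewrite -(@sum_Fp_box R (spval p) z.+1 t (fun=> 1)) ?spval_prime //.
    by rewrite sumr_const.
  by rewrite ltnW // ltnS spval_le.
have K0 : 0 < K.
  rewrite KE; apply: prodr_gt0 => p _; rewrite ltr0n; apply/card_gt0P; by exists 0.
have ldE x : \prod_p local_density R W A (spval p) (base x) (Q p) =
    (\sum_(f in family Box) \prod_p (b x p (f p))%:R) / K.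
  rewrite KE -(bigA_distr_big_dep Box (fun p g => (b x p g)%:R)) -prodf_div; apply: eq_bigr => p _.
  rewrite /local_density /expect; congr (_ / _).
  rewrite (@sum_Fp_box R (spval p) z.+1) ?spval_prime //.
  by rewrite ltnW // ltnS spval_le.
under [X in _ - X]eq_bigr do rewrite ldE.
rewrite -mulr_suml exchange_big /=.
have -> : \sum_x (C x)%:R = (\sum_(f in family Box) \sum_x (C x)%:R) / K.
  by rewrite sumr_const -[in RHS]mulr_natr /K sumr_const mulfK // gt_eqF // -[X in 0 < X]sumr_const.
rewrite -mulrBl -sumrB normrM normfV (gtr0_norm K0) ler_pdivrMr //.
apply: le_trans (ler_norm_sum _ _ _) _.
rewrite /K mulr_sumr; apply: ler_sum => f fB; rewrite mulr1.
(* The Chinese remainder theorem realises f by integers below the product of U, the primes that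
   carry a condition; this is where the size of M comes from. *)
have [h hU hf] : exists2 h : 'I_t -> nat, (forall j, (h j < sprod U)%N) &
    forall j p, p \in U -> h j = f p j %[mod spval p].
  suff H j : exists2 n, (n < sprod U)%N & forall p, p \in U -> n = f p j %[mod spval p].
    by have [h h1 h2] := fin_all_exists2 H; exists h.
  have := @crt_exists T (enum U) (@spval y z) (fun p => f p j) (enum_uniq _) _ _.
  rewrite big_enum /=; case=> [p _|p q _ _|n n1 n2].
  - by rewrite prime_gt0 ?spval_prime.
  - exact: coprime_spval.
  - by exists n => // p pU; rewrite n2 // mem_enum.
have [s s_inj psi_s] := psi_shift h.
rewrite (reindex_inj s_inj) -sumrB; apply: le_trans (ler_norm_sum _ _ _) _.
have -> : #|wrap_set M|%:R = \sum_x (x \in wrap_set M)%:R :> R.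
  by rewrite sum_const_indicator.
apply: ler_sum => x _; rewrite prod_indicator.
case xW: (x \in wrap_set M).
  by case: (C _); case: [forall p, _]; rewrite ?subrr ?sub0r ?subr0 ?normrN ?normr1 ?normr0.
rewrite (_ : C (s x) = [forall p, b x p (f p)]) ?subrr ?normr0 //.
apply: eq_forallb => p; apply: eq_forallb_in => i iQ.
have pU : p \in U by rewrite inE; apply/set0Pn; exists i.
have pp := spval_prime p.
rewrite -(natr_Fp_eq0 _ pp) /root_cond natrD natrM.
set a := \sum_j A i j * (h j)%:Z in psi_s.
have aM : `|a| <= M%:Z.
  apply: le_trans (ler_norm_sum _ _ _) _.
  apply: (@le_trans _ _ (\sum_(j < t) (B * sprod U)%:Z)).
    apply: ler_sum => j _; rewrite normrM PoszM ler_pM ?normr_ge0 //.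
    by rewrite ger0_norm // lez_nat ltnW.
  by rewrite sumr_const card_ord -mulr_natr -natz !natz -PoszM lez_nat; lia.
have vE : (psi i (s x) : nat)%:Z = (psi i x : nat)%:Z + a.
  rewrite psi_s val_addFp_int //; move/negbT: xW.
  rewrite inE negb_exists => /forallP/(_ i); rewrite negbK => /andP[h1 h2].
  move: aM h1 h2; rewrite /a; move: (\sum_j _) => a'; lia.
suff -> : (psi i (s x))%:R = (base x i)%:R + \sum_j (A i j)%:~R * row p (f p) 0 j :> 'F_(spval p) by [].
rewrite pmulrn vE intrD -pmulrn; congr (_ + _).
rewrite rmorph_sum; apply: eq_bigr => j _; rewrite mxE rmorphM /=; congr (_ * _).
by rewrite -[LHS]pmulrn -(Fp_nat_mod pp (h j)) hf // Fp_nat_mod.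
Qed.

Lemma card_ord_interval (n a l : nat) (P : pred 'I_n) :
  (forall c, P c -> a <= c < a + l)%N -> (#|P| <= l)%N.
Proof.
move=> h; rewrite -[X in (_ <= X)%N](size_iota a) cardE -(size_map val).
apply: uniq_leq_size; first by rewrite map_inj_uniq ?enum_uniq //; apply: val_inj.
by move=> _ /mapP[c + ->]; rewrite mem_enum mem_iota => /h.
Qed.

Hypothesis psi_equi : forall i (c : 'F_N), (#|[set x | psi i x == c]| * N <= #|X|)%N.

(** At most 2M residues lie near the ends of the interval, and each of the m forms takes a given
    value on at most #|X| / N points. *)
Lemma card_wrap_set (M : nat) : (#|wrap_set M| * N <= 2 * m * M * #|X|)%N.
Proof.
have bad_le : (#|[pred c : 'F_N | ~~ ((M <= c) && (c + M < N))%N]| <= M + M)%N.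
  apply: (@leq_trans (#|[pred c : 'F_N | c < M]%N| + #|[pred c : 'F_N | N - M <= c]%N|)).
    rewrite -cardUI; apply: leq_trans (leq_addr _ _); apply: subset_leq_card.
    by apply/subsetP => c; rewrite !inE; lia.
  apply: leq_add; first by apply: (@card_ord_interval _ 0) => c /=; rewrite add0n.
  apply: (@card_ord_interval _ (N - M)) => c /= h; rewrite h /=.
  by have := ltn_ord c; rewrite [X in (_ < X)%N -> _]Fp_cast //; lia.
apply: (@leq_trans (\sum_(i < m) \sum_(c : 'F_N | ~~ ((M <= c) && (c + M < N))%N)
    #|[set x | psi i x == c]| * N)).
  have -> : (\sum_(i < m) \sum_(c : 'F_N | ~~ ((M <= c) && (c + M < N))%N)
    #|[set x | psi i x == c]| * N =
    (\sum_x \sum_(i < m) (~~ ((M <= psi i x) && (psi i x + M < N)))) * N)%N.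
    rewrite [in RHS]exchange_big big_distrl /=; apply: eq_bigr => i _; rewrite -big_distrl; congr (_ * _)%N.
    rewrite [RHS](partition_big (psi i) xpredT) //= [LHS]big_mkcond; apply: eq_bigr => c _.
    rewrite (eq_bigr (fun=> nat_of_bool (~~ ((M <= c) && (c + M < N))%N))); last first.
      by move=> x /eqP ->.
    rewrite sum_nat_const; case: ifP => _; rewrite ?muln0 ?muln1 //.
    by apply: eq_card => x; rewrite inE.
  rewrite leq_mul2r -sum1_card [X in (X <= _)%N]big_mkcond; apply/orP; right.
  apply: leq_sum => x _; case: ifP => //; rewrite inE => /existsP[i h].
  by rewrite (bigD1 i) //= h.
apply: (@leq_trans (\sum_(i < m) (M + M) * #|X|)).
  apply: leq_sum => i _; apply: leq_trans (leq_mul bad_le (leqnn _)).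
  rewrite -sum_nat_const; apply: leq_sum => c _; exact: psi_equi.
by rewrite sum_nat_const card_ord; lia.
Qed.

Hypothesis z0 : (0 < z)%N.
Local Notation lam := (@selberg_weight y z R).
Local Notation G := (selberg_sum y z R).
Local Notation nu := (selberg_nu y z R W).
Local Notation vR := (@spvalR y z R).

Lemma selberg_nuE n : nu n = G * \sum_(IJ : {set T} * {set T}) lam IJ.1 * lam IJ.2 *
   [forall p, (p \in IJ.1 :|: IJ.2) ==> (spval p %| W * n + 1)%N]%:R.
Proof.
rewrite /selberg_nu; congr (_ * _); rewrite expr2 big_distrlr /= pair_big /=.
rewrite big_mkcond; apply: eq_bigr => -[I J] _ /=.
rewrite -subUset (_ : _ \subset _ = [forall p, (p \in I :|: J) ==> (spval p %| W * n + 1)%N]).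
  by case: [forall p, _]; rewrite ?mulr1 ?mulr0.
apply/subsetP/forallP => h p; first by apply/implyP => /h; rewrite inE.
by have /implyP hp := h p; move=> /hp; rewrite inE.
Qed.

Local Notation family := {ffun 'I_m -> {set T} * {set T}}.

Definition fam_cond (F : family) x :=
  [forall p, [forall (i | i \in fam_supp F p), (spval p %| W * psi i x + 1)%N]].

Lemma prod_nuE x : \prod_i nu (psi i x) =
  G ^+ m * \sum_(F : family) fam_weight vR (@slevel y z) F * (fam_cond F x)%:R.
Proof.
under eq_bigr do rewrite selberg_nuE.
rewrite big_split /= prodr_const card_ord; congr (_ * _).
rewrite bigA_distr_bigA; apply: eq_bigr => F _.
rewrite big_split /= prod_indicator; congr (_ * _%:R); congr nat_of_bool.
apply/forallP/forallP => h.
  by move=> p; apply/forallP => i; apply/implyP; rewrite inE => pi; have /forallP/(_ p)/implyP := h i; apply.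
move=> i; apply/forallP => p; apply/implyP => pi.
by have /forallP/(_ i)/implyP := h p; apply; rewrite inE.
Qed.

Lemma sum_norm_fam_weight :
  \sum_(F : family) `|fam_weight vR (@slevel y z) F| <= z.+1%:R ^+ (4 * m) :> R.
Proof.
under eq_bigr do rewrite normr_prod.
rewrite -(bigA_distr_bigA (fun i (IJ : {set T} * {set T}) => `|lam IJ.1 * lam IJ.2|)).
rewrite prodr_const card_ord exprM lerXn2r ?nnegrE ?sumr_ge0 ?exprn_ge0 //.
under eq_bigr do rewrite normrM.
rewrite -(pair_bigA _ (fun I J : {set T} => `|lam I| * `|lam J|)) /= -big_distrlr /=.
rewrite (exprM _ 2 2) expr2.
by have h := sum_norm_selberg_weight y R z0; apply: ler_pM; rewrite ?sumr_ge0.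
Qed.

(** A non-zero weight forces all 2m divisors to be at most z, which bounds the modulus needed for
    shifting. *)
Lemma fam_supp_level (F : family) : fam_weight vR (@slevel y z) F != 0 ->
  (sprod [set p | fam_supp F p != set0] <= z ^ (2 * m))%N.
Proof.
rewrite prodf_seq_neq0 => /allP h.
have hS i : slevel (F i).1 /\ slevel (F i).2.
  have := h i (mem_index_enum _); rewrite /= mulf_eq0 negb_or => /andP[h1 h2].
  by split; [apply: contraNT h1|apply: contraNT h2] => nS; apply/eqP/(selberg_weight_out R nS).
apply: (@leq_trans (\prod_(i < m) (sprod (F i).1 * sprod (F i).2))%N).
  apply: dvdn_leq; first by apply: prodn_cond_gt0 => i _; rewrite muln_gt0 !sprod_gt0.
  rewrite sprod_dvd; apply/subsetP => p; rewrite !inE => /set0Pn[i].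
  rewrite !inE (bigD1 i) //= => /orP[] pi; apply: dvdn_mulr.
    by rewrite dvdn_mulr // dvdn_sprod.
  by rewrite dvdn_mull // dvdn_sprod.
apply: (@leq_trans (\prod_(i < m) (z * z))%N).
  by apply: leq_prod => i _; have [h1 h2] := hS i; apply: leq_mul.
by rewrite prod_nat_const card_ord expnM -mulnn.
Qed.

(** The main term is estimated for each base point x separately, since the densities may depend on
    x. The exponent 7m collects m from G^m, 4m from the sum of the weights and 2m from the
    modulus. *)
Theorem expect_prod_selberg (d : T -> R) : (0 < #|X|)%N ->
  (forall x p Q, `|local_density R W A (spval p) (base x) Q - vR p ^- #|Q| | <= d p) ->
  `|expect (fun x => \prod_i nu (psi i x)) - 1| <=
    (\prod_p (1 + 16 ^+ m * d p) - 1) +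
    (2 * m * (t * B))%:R * z.+1%:R ^+ (7 * m) / N%:R.
Proof.
move=> X0 hd.
have z1 : (1 : R) <= z.+1%:R by rewrite ler1n.
have XR0 : (0 : R) < #|X|%:R by rewrite ltr0n.
have N0 : (0 : R) < N%:R by rewrite ltr0n prime_gt0.
have G0 : 0 <= G by rewrite ltW // selberg_sum_gt0.
pose M := (t * B * z ^ (2 * m))%N.
pose rho x (p : T) Q := local_density R W A (spval p) (base x) Q.
pose main x := G ^+ m * sieve_main vR (@slevel y z) (rho x).
have hmain x : `|main x - 1| <= \prod_p (1 + 16 ^+ m * d p) - 1.
  exact: (sieve_main_asymp (@spvalR_ge2 y z R) (slevel0 y z0) (@slevelS y z) (hd x)).
have step : `|\sum_x \prod_i nu (psi i x) - \sum_x main x| <= z.+1%:R ^+ (5 * m) * #|wrap_set M|%:R.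
  under eq_bigr do rewrite prod_nuE.
  rewrite /main /sieve_main -!mulr_sumr.
  rewrite exchange_big /= [X in _ - _ * X]exchange_big -mulrBr -sumrB /=.
  have e5 : (5 * m = m + 4 * m)%N by lia.
  rewrite normrM normrX (ger0_norm G0) e5 exprD.
  rewrite -mulrA; apply: ler_pM; rewrite ?exprn_ge0 ?normr_ge0 //.
    by apply: lerXn2r; rewrite ?nnegrE //; apply: selberg_sum_le.
  apply: le_trans (ler_norm_sum _ _ _) _.
  apply: (@le_trans _ _ (\sum_(F : family) `|fam_weight vR (@slevel y z) F| * #|wrap_set M|%:R)).
    apply: ler_sum => F _; rewrite -!mulr_sumr -mulrBr normrM.
    have [->|/fam_supp_level Fz] := eqVneq (fam_weight vR (@slevel y z) F) 0.
      by rewrite normr0 !mul0r.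
    apply: ler_wpM2l => //; apply: shift_average.
    by rewrite /M leq_mul2l Fz orbT.
  rewrite -mulr_suml; apply: ler_wpM2r => //; exact: sum_norm_fam_weight.
rewrite /expect.
have -> : (\sum_x \prod_i nu (psi i x)) / #|X|%:R - 1 =
   (\sum_x (main x - 1)) / #|X|%:R + (\sum_x \prod_i nu (psi i x) - \sum_x main x) / #|X|%:R.
  by rewrite sumrB sumr_const -mulrDl mulrDl; field; rewrite gt_eqF.
apply: le_trans (ler_normD _ _) _; apply: lerD.
  rewrite normrM normfV (gtr0_norm XR0) ler_pdivrMr //.
  apply: le_trans (ler_norm_sum _ _ _) _.
  rewrite mulr_natr -sumr_const; apply: ler_sum => x _; exact: hmain.
rewrite normrM normfV (gtr0_norm XR0) ler_pdivrMr //.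
apply: le_trans step _.
rewrite mulrAC ler_pdivlMr // -mulrA.
apply: (@le_trans _ _ (z.+1%:R ^+ (5 * m) * (2 * m * M * #|X|)%:R)).
  by apply: ler_wpM2l; rewrite ?exprn_ge0 // -natrM ler_nat card_wrap_set.
have -> : (7 * m = 5 * m + 2 * m)%N by lia.
rewrite exprD mulrCA -!mulrA; apply: ler_wpM2l; rewrite ?exprn_ge0 //.
rewrite mulrA -natrX -!natrM ler_nat /M !mulnA leq_mul2r; apply/orP; right.
rewrite -!mulnA !leq_mul2l; do !(apply/orP; right).
case: (posnP (2 * m)) => [->|h]; first by rewrite !expn0.
by rewrite leq_exp2r // leqnSn.
Qed.

End Core.

(** * Local densities *)

Lemma expect_indicator (R : realType) (X : finType) (b : pred X) :
  expect (fun x => (b x)%:R) = #|b|%:R / #|X|%:R :> R.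
Proof. by rewrite /expect sum_const_indicator. Qed.

Section LocalDensityBounds.
Variables (R : realType) (W m t : nat) (A : 'M[int]_(m, t)) (p : nat) (c : 'I_m -> nat).
Hypothesis pp : prime p.
Hypothesis Wp : ~~ (p %| W)%N.
Local Notation ld := (local_density R W A p c).
Local Notation vec := 'rV['F_p]_t.

Let W0 : W%:R != 0 :> 'F_p. Proof. by rewrite natr_Fp_eq0. Qed.
Let p0 : (0 : R) < p%:R. Proof. by rewrite ltr0n prime_gt0. Qed.

Lemma local_density_ge0 Q : 0 <= ld Q.
Proof. by rewrite /local_density expect_indicator. Qed.

Lemma local_densityS (Q Q' : {set 'I_m}) : Q' \subset Q -> ld Q <= ld Q'.
Proof.
move=> sQ; rewrite /local_density !expect_indicator; apply: ler_wpM2r => //.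
rewrite ler_nat; apply: subset_leq_card; apply/subsetP => x.
rewrite -!topredE /= => /forallP h; apply/forallP => i; apply/implyP => iQ.
by have /implyP := h i; apply; apply: (subsetP sQ).
Qed.

Lemma local_density0 : ld set0 = 1.
Proof.
rewrite /local_density expect_indicator (eq_card (B := {: vec})) => [|x].
  by rewrite divff // pnatr_eq0 -lt0n; apply/card_gt0P; exists 0.
by rewrite -topredE /=; apply/forallP => i; rewrite inE.
Qed.

Lemma root_condE i (x : vec) :
  root_cond W A c i x = (\sum_j (A i j)%:~R * x 0 j == - (W%:R^-1) - (c i)%:R).
Proof.
rewrite /root_cond addr_eq0 -(inj_eq (mulfI (invr_neq0 W0))) mulKf // mulrN1.
by rewrite eq_sym [RHS]eq_sym subr_eq addrC.
Qed.

Lemma card_vec_ratio (k r : nat) : (k * p ^ r = p ^ t)%N ->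
  k%:R / #|{: vec}|%:R = p%:R ^- r :> R.
Proof.
rewrite card_mx card_Fp // mul1n => e; rewrite -e natrM natrX.
have k0 : k%:R != 0 :> R.
  have : (0 < p ^ t)%N by rewrite expn_gt0 prime_gt0.
  by rewrite -e pnatr_eq0; case: k {e}.
by rewrite invfM mulVKf.
Qed.

Lemma local_density1 i : (exists j, (A i j)%:~R != 0 :> 'F_p) -> ld [set i] = p%:R^-1.
Proof.
case=> j Aij; rewrite /local_density expect_indicator.
pose a : 'M['F_p]_(t, 1) := \col_j (A i j)%:~R.
have fa : row_full a.
  apply/row_fullP; exists ((A i j)%:~R^-1 *: delta_mx 0 j).
  apply/matrixP => u v; rewrite -scalemxAl -rowE !mxE !ord1 mulVf //.
have := card_linear_fiber (const_mx (- (W%:R^-1) - (c i)%:R)) fa.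
rewrite card_Fp // => /card_vec_ratio; rewrite expr1 => <-; congr (_%:R / _).
apply: eq_card => x; rewrite inE -topredE /=.
apply/forallP/eqP => [/(_ i)|h k].
  rewrite set11 /= root_condE => /eqP h; apply/matrixP => u v; rewrite !mxE !ord1 -h.
  by apply: eq_bigr => l _; rewrite mxE mulrC.
apply/implyP; rewrite inE => /eqP ->; rewrite root_condE.
move/matrixP: h => /(_ 0 0); rewrite !mxE => <-.
by apply/eqP/eq_bigr => l _; rewrite mxE mulrC.
Qed.

Lemma local_density2 i i' j j' :
  (A i j * A i' j' - A i j' * A i' j)%:~R != 0 :> 'F_p -> ld [set i; i'] <= p%:R ^- 2.
Proof.
move=> minor; rewrite /local_density expect_indicator.
pose a : 'M['F_p]_(t, 2) := \matrix_(u, l) (A (if l == 0 then i else i') u)%:~R.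
have fa : row_full a.
  (* [P] selects the rows j and j' of [a], so that [P *m a] has the given minor as its
     determinant. *)
  pose P : 'M['F_p]_(2, t) := \matrix_(l, u) (u == if l == 0 then j else j')%:R.
  have Pa : P *m a = \matrix_(l, l') a (if l == 0 then j else j') l'.
    apply/matrixP => u v; rewrite !mxE (bigD1 (if u == 0 then j else j')) //= !mxE eqxx mul1r.
    by rewrite big1 ?addr0 // => l /negbTE h; rewrite !mxE h mul0r.
  have u : P *m a \in unitmx.
    rewrite Pa unitmxE unitfE (expand_det_row _ 0) !big_ord_recl big_ord0 /cofactor !det_mx11 !mxE /=.
    by move: minor; rewrite rmorphB !rmorphM /= expr0 expr1 mul1r mulN1r addr0 mulrN mulrC [X in _ - X]mulrC.
  apply/row_fullP; exists (invmx (P *m a) *m P); rewrite -mulmxA mulVmx //.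
pose b : 'rV['F_p]_2 := \row_l (- (W%:R^-1) - (c (if l == 0 then i else i'))%:R).
have := card_linear_fiber b fa.
rewrite card_Fp // => /card_vec_ratio <-; apply: ler_wpM2r => //; rewrite ler_nat.
apply: subset_leq_card; apply/subsetP => x; rewrite inE -topredE /= => /forallP h.
apply/eqP/rowP => l; rewrite !mxE.
have /implyP := h (if l == 0 then i else i'); rewrite !inE.
rewrite root_condE => /(_ _)/eqP <-; last by case: ifP; rewrite eqxx ?orbT.
by apply: eq_bigr => u _; rewrite !mxE mulrC.
Qed.

(** For at most one condition the density is exactly the independent one. For two or more, both
    quantities lie between 0 and d: the density by monotonicity in Q, the power of p because #|Q| >=
    2. *)
Lemma local_density_close (d : R) (Q : {set 'I_m}) :
  (forall i, exists j, (A i j)%:~R != 0 :> 'F_p) ->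
  (forall i i', i != i' -> ld [set i; i'] <= d) -> p%:R ^- 2 <= d ->
  `|ld Q - p%:R ^- #|Q| | <= d.
Proof.
move=> h1 h2 h3; have d0 : 0 <= d by apply: le_trans h3; rewrite invr_ge0 exprn_ge0 // ltW.
have [Q1|Q2] := leqP #|Q| 1.
  suff -> : ld Q = p%:R ^- #|Q| by rewrite subrr normr0.
  move: Q1; rewrite leq_eqVlt ltnS leqn0 => /orP[/cards1P[i ->]|].
    by rewrite cards1 expr1 local_density1.
  by rewrite cards_eq0 => /eqP ->; rewrite cards0 expr0 invr1 local_density0.
have /card_gt1P[i [i' [iQ i'Q ii']]] := Q2.
have l1 : ld Q <= d.
  apply: le_trans (h2 _ _ ii'); apply: local_densityS.
  by apply/subsetP => k; rewrite !inE => /orP[]/eqP ->.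
have l2 : p%:R ^- #|Q| <= d.
  apply: le_trans h3; rewrite lef_pV2 ?posrE ?exprn_gt0 // ler_weXn2l // ler1n prime_gt0 //.
have := local_density_ge0 Q.
have : 0 <= (p%:R : R) ^- #|Q| by rewrite invr_ge0 exprn_ge0 // ltW.
by move: l1 l2; move: (ld Q) (_ ^- _) => u v; rewrite ler_norml; lra.
Qed.

End LocalDensityBounds.

(** * Sums over primes *)

Lemma big_sieve_prime (V : Type) (idx : V) (op : Monoid.com_law idx) (y z : nat) (F : nat -> V) :
  \big[op/idx]_(p : sieve_prime y z) F (spval p) =
  \big[op/idx]_(p < z.+1 | prime p && (y < p)%N) F p.
Proof.
pose P := [pred p : 'I_z.+1 | prime p && (y < p)%N].
exact/esym/(big_sub P (fun p : 'I_z.+1 => F p)).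
Qed.

Section Bounds.
Variable R : realType.

Lemma sum_inv_sqr_tail (y z : nat) : (0 < y)%N ->
  \sum_(y.+1 <= n < z.+1) (n%:R ^- 2 : R) <= y%:R^-1.
Proof.
move=> y0; have [yz|zy] := leqP y z; last first.
  by rewrite big_geq ?invr_ge0 // ltnW.
apply: (@le_trans _ _ (y%:R^-1 - z%:R^-1)); last by rewrite gerBl invr_ge0.
rewrite -opprB -(telescope_sumr (fun n => n%:R^-1 : R) yz) -sumrN.
rewrite big_add1 /=; apply: ler_sum_nat => n /andP[yn _].
have n0 : (0 : R) < n%:R by rewrite ltr0n (leq_trans y0).
rewrite -natr1; set a : R := n%:R in n0 *.
have -> : - ((a + 1)^-1 - a^-1) = ((a + 1) * a)^-1.
  by field; rewrite !gt_eqF // ltr_wpDr.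
by rewrite lef_pV2 ?posrE ?exprn_gt0 ?mulr_gt0 ?ltr_wpDr // expr2 ler_pM2l ?ltr_wpDr // lerDl.
Qed.

Lemma prod_sieve_prime_le (y z : nat) (K : R) : (0 < y)%N -> 0 <= K ->
  \prod_(p : sieve_prime y z) (1 + K * (spval p)%:R ^- 2) <= expR (K / y%:R).
Proof.
move=> y0 K0.
apply: (@le_trans _ _ (\prod_(p : sieve_prime y z) expR (K * (spval p)%:R ^- 2))).
  by apply: ler_prod => p _; rewrite addr_ge0 ?mulr_ge0 ?invr_ge0 ?exprn_ge0 // expR_ge1Dx.
rewrite -expR_sum ler_expR -mulr_sumr; apply: ler_wpM2l => //.
apply: le_trans (sum_inv_sqr_tail z y0).
rewrite (big_sieve_prime _ _ _ (fun n => n%:R ^- 2 : R)).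
rewrite (big_nat_widenl _ 0) // big_mkord [leLHS]big_mkcond [leRHS]big_mkcond.
apply: ler_sum => p _; rewrite /=; case: (prime p) => //=.
by case: ifP; rewrite ?invr_ge0 ?exprn_ge0.
Qed.

Lemma totient_prod_primes n :
  totient (\prod_(0 <= p < n | prime p) p) = (\prod_(0 <= p < n | prime p) p.-1)%N.
Proof.
elim: n => [|n IH]; first by rewrite !big_geq.
have rec F : (\prod_(0 <= p < n.+1 | prime p) F p =
    \prod_(0 <= p < n | prime p) F p * (if prime n then F n else 1))%N.
  by rewrite big_mkcond big_nat_recr //= -big_mkcond.
rewrite !rec.
case: ifP => pn; last by rewrite !muln1.
rewrite totient_coprime ?IH ?totient_prime // coprime_sym.
rewrite big_seq_cond; elim/big_ind: _ => [|a b ca cb|q]; rewrite ?coprimen1 ?coprimeMr ?ca //.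
rewrite mem_index_iota => /andP[/andP[_ qn] pq].
by rewrite prime_coprime // dvdn_prime2 // gtn_eqF.
Qed.

(** Integer version of [primorial]; [primorial x] is convertible to its value at [Num.truncn x]. *)
Definition primorialn (y : nat) : nat := (\prod_(0 <= p < y.+1 | prime p) p)%N.

Lemma primorialn_gt0 y : (0 < primorialn y)%N.
Proof. by apply: prodn_cond_gt0 => p; apply: prime_gt0. Qed.

Lemma primorialn_le_fact y : (primorialn y <= y`!)%N.
Proof.
rewrite fact_prod /primorialn big_ltn_cond //= big_mkcond big_seq [X in (_ <= X)%N]big_seq; apply: leq_prod => p.
by rewrite mem_index_iota; case: ifP => // _ /andP[].
Qed.

Lemma dvdn_primorialn y p : prime p -> (p %| primorialn y)%N = (p <= y)%N.
Proof.
move=> pp; apply/idP/idP => [|py].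
  apply: contraTT; rewrite -ltnNge => yp; rewrite -prime_coprime // /primorialn.
  rewrite big_seq_cond; elim/big_ind: _ => [|a b ca cb|q]; rewrite ?coprimen1 ?coprimeMr ?ca //.
  rewrite mem_index_iota => /andP[/andP[_ qn] pq].
  by rewrite prime_coprime // dvdn_prime2 // gtn_eqF // (leq_trans qn).
rewrite /primorialn big_mkord (bigD1 (Ordinal (py : p < y.+1)%N)) //=.
by rewrite dvdn_mulr.
Qed.

Lemma primorialn_totient y : (primorialn y)%:R / (totient (primorialn y))%:R =
  \prod_(0 <= p < y.+1 | prime p) (p%:R / p.-1%:R) :> R.
Proof. by rewrite totient_prod_primes prodf_div !natr_prod. Qed.

Lemma ler_sum_inj (I J : finType) (P : pred I) (Q : pred J) (e : I -> J) (F : J -> R) :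
  {in P &, injective e} -> (forall i, P i -> Q (e i)) -> (forall j, 0 <= F j) ->
  \sum_(i | P i) F (e i) <= \sum_(j | Q j) F j.
Proof.
move=> e_inj PQ F0; rewrite -(big_imset F e_inj) [leLHS]big_mkcond [leRHS]big_mkcond.
apply: ler_sum => j _; case: imsetP => [[i Pi ->]|_]; first by rewrite PQ.
by case: ifP.
Qed.

Lemma sum_geometric_le (p n : nat) : (1 < p)%N ->
  \sum_(a < n) p%:R ^- a <= p%:R / p.-1%:R :> R.
Proof.
case: p => [|[|p]] // _ /=; set q : R := p.+2%:R.
have q0 : 0 < q by rewrite ltr0n.
have q1 : 0 < p.+1%:R :> R by rewrite ltr0n.
have qE : q = p.+1%:R + 1 by rewrite natr1.
suff : (\sum_(a < n) q ^- a) * p.+1%:R = q - q * q ^- n.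
  by move=> e; rewrite ler_pdivlMr // e gerBl mulr_ge0 ?invr_ge0 ?exprn_ge0 // ltW.
elim: n => [|n IH]; first by rewrite big_ord0 expr0 invr1 mulr1 subrr mul0r.
rewrite big_ord_recr /= mulrDl IH exprS invfM; set u := q ^- n.
have -> : p.+1%:R = q - 1 by rewrite qE addrK.
by field; rewrite gt_eqF.
Qed.

Lemma sum_geometric_pos_le (p n : nat) : (1 < p)%N ->
  \sum_(a < n.+1 | (0 < a)%N) p%:R ^- a <= (p%:R - 1)^-1 :> R.
Proof.
move=> p1; have := sum_geometric_le n.+1 p1.
rewrite (bigD1 ord0) //= expr0 invr1.
rewrite (eq_bigl (fun a : 'I_n.+1 => 0 < a)%N) => [|a]; last by rewrite lt0n.
case: p p1 => [|[|p]] // _ /=; have -> : p.+2%:R - 1 = p.+1%:R :> R by rewrite -natr1 addrK.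
have -> : p.+2%:R / p.+1%:R = 1 + p.+1%:R^-1 :> R.
  by rewrite -natr1 mulrDl divff ?mul1r // pnatr_eq0.
by rewrite lerD2l.
Qed.

(** Sort the integers up to z by the set r of their prime factors above y; r has product at most z.
    Relaxing to all exponent vectors that are positive on r, zero at other primes above y and free
    up to y, geometric series give 1/phi(r) times the product of p/(p-1) over p <= y. *)
Lemma harmonic_selberg_sum (y z : nat) : (y <= z)%N ->
  \sum_(n < z) n.+1%:R^-1 <=
    selberg_sum y z R * \prod_(0 <= p < y.+1 | prime p) (p%:R / p.-1%:R).
Proof.
move=> yz.
pose D (n : nat) : {set sieve_prime y z} := [set p | spval p %| n]%N.
pose e (n : 'I_z) : {ffun 'I_z.+1 -> 'I_z.+1} := [ffun p => inord (logn (p : 'I_z.+1) n.+1)].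
have eE (n : 'I_z) p : e n p = logn p n.+1 :> nat.
  rewrite ffunE inordK //; apply: leq_trans (ltn_logl p (ltn0Sn n)) _.
  by apply: leq_trans (ltn_ord n) _.
pose F (p a : 'I_z.+1) : R := p%:R ^- a.
(* The exponents a allowed at the index p; composite indices, 0 and 1 are forced to exponent 0 and
   contribute the factor 1. *)
pose Q (r : {set sieve_prime y z}) (p a : 'I_z.+1) : bool :=
  if prime p then (if (y < p)%N then (p %| sprod r) == (0 < a) else true)%N else (a == 0 :> nat).
have FE (n : 'I_z) : n.+1%:R^-1 = \prod_p F p (e n p).
  rewrite /F prodfV; congr (_^-1); rewrite -{1}(partnT (ltn0Sn n)).
  rewrite (widen_partn predT (ltn_ord n)) natr_prod big_mkord.
  by apply: eq_bigr => p _; rewrite natrX eE.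
have e_inj : injective e.
  move=> n1 n2 en; apply: val_inj; apply: succn_inj; apply: eqn_from_log => // p.
  have [pz|zp] := leqP p z.
    by have := congr1 (fun f : {ffun _ -> _} => val (f (inord p))) en; rewrite /= !eE inordK.
  have l0 (n : 'I_z) : logn p n.+1 = 0%N.
    apply/eqP; rewrite -leqn0 leqNgt logn_gt0 mem_primes !negb_and; apply/orP; right.
    by apply/orP; right; apply/negP => /(dvdn_leq (ltn0Sn n)); have := ltn_ord n; lia.
  by rewrite !l0.
have eQ (n : 'I_z) : e n \in family (Q (D n.+1)).
  apply/familyP => p; rewrite -topredE /= /Q eE.
  case: ifP => pp; last by rewrite lognE pp.
  case: ifP => // yp; apply/eqP; rewrite logn_gt0 mem_primes pp /=.
  have pP : prime p && (y < p)%N by rewrite pp.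
  by have := dvdn_sprod (D n.+1) (exist _ p pP); rewrite inE.
have DS (n : 'I_z) : slevel (D n.+1).
  apply: leq_trans (ltn_ord n); apply: dvdn_leq => //.
  by rewrite sprod_dvd.
rewrite (partition_big (fun n : 'I_z => D n.+1) (@slevel y z)) //=.
rewrite /selberg_sum /sieve_sum mulr_suml; apply: ler_sum => r _.
apply: (@le_trans _ _ (\sum_(f in family (Q r)) \prod_p F p (f p))).
  under eq_bigr do rewrite FE.
  apply: (@ler_sum_inj _ _ _ _ e (fun f => \prod_p F p (f p))) => [n1 n2 _ _ /e_inj //|n /eqP <- //|f].
  by apply: prodr_ge0 => p _; rewrite invr_ge0 exprn_ge0.
rewrite -(bigA_distr_big_dep (Q r) F).
pose B (p : nat) : R := if prime p then
   (if (y < p)%N then (if (p %| sprod r)%N then (p%:R - 1)^-1 else 1) else p%:R / p.-1%:R) else 1.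
apply: (@le_trans _ _ (\prod_(p < z.+1) B p)).
  apply: ler_prod => p _; rewrite sumr_ge0 /=; last first.
    by move=> a _; rewrite invr_ge0 exprn_ge0.
  have one : \sum_(a < z.+1 | (a == 0 :> nat)%N) F p a = 1.
    rewrite (big_pred1 ord0) => [|a]; last by [].
    by rewrite /F expr0 invr1.
  rewrite /B /Q; case: ifP => pp; last by rewrite one.
  case: ifP => yp; last exact: (sum_geometric_le _ (prime_gt1 pp)).
  case: ifP => pr.
    exact: (sum_geometric_pos_le _ (prime_gt1 pp)).
  rewrite -[X in _ <= X]one le_eqVlt; apply/orP; left; apply/eqP; apply: eq_bigl => a.
  by case: (nat_of_ord a).
rewrite (bigID (fun p : 'I_z.+1 => prime p && (y < p)%N)) /=.
rewrite le_eqVlt; apply/orP; left; apply/eqP; congr (_ * _).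
  rewrite -(big_sieve_prime _ _ _ B) /sphi -prodfV [RHS]big_mkcond /=; apply: eq_bigr => p _.
  by rewrite /B spval_prime spval_gt dvdn_sprod.
rewrite big_mkord (@big_ord_widen_cond _ _ _ _ z.+1 prime (fun p => p%:R / p.-1%:R)) ?ltnS // [LHS]big_mkcond [RHS]big_mkcond.
apply: eq_bigr => p _; rewrite /B ltnS -[(p <= y)%N]negbK -ltnNge.
by case: (prime p); case: (y < p)%N.
Qed.

Lemma ln_le_harmonic (z : nat) : ln z.+1%:R <= \sum_(n < z) n.+1%:R^-1 :> R.
Proof.
elim: z => [|z IH]; first by rewrite big_ord0 ln1.
rewrite big_ord_recr /=.
have -> : z.+2%:R = z.+1%:R * (1 + z.+1%:R^-1) :> R.
  by rewrite mulrDr mulr1 divff ?pnatr_eq0 // natr1.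
have i0 : (0 : R) < z.+1%:R^-1 by rewrite invr_gt0.
rewrite lnM ?posrE ?ltr0n // ?addr_gt0 //; apply: lerD => //.
by apply: le_ln1Dx; apply: lt_trans i0; rewrite ltrN10.
Qed.

Lemma ln_le_selberg_sum (y z : nat) : (y <= z)%N ->
  (totient (primorialn y))%:R / (primorialn y)%:R * ln z.+1%:R <= selberg_sum y z R.
Proof.
move=> yz; have W0 : (0 : R) < (primorialn y)%:R by rewrite ltr0n primorialn_gt0.
have f0 : (0 : R) < (totient (primorialn y))%:R by rewrite ltr0n totient_gt0 primorialn_gt0.
rewrite mulrAC ler_pdivrMr // mulrC -ler_pdivlMr // -mulrA primorialn_totient.
exact: le_trans (ln_le_harmonic z) (harmonic_selberg_sum yz).
Qed.

End Bounds.

(** * Pointwise and moment bounds *)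

(** Used with s the number of primes in a squarefree divisor of n: as s! is at most their product,
    M^s is then O_M(n). Applied to large M, this is the divisor bound n^o(1). *)
Lemma expn_le_fact (M s : nat) : (M ^ s <= M ^ M * s`!)%N.
Proof.
elim: s => [|s IH]; first by rewrite expn0 muln1; case: M => // M; rewrite expn_gt0.
have [sM|Ms] := leqP s.+1 M.
  have [M0|M0] := posnP M; first by rewrite M0 in sM.
  by apply: leq_trans (leq_pexp2l M0 sM) _; rewrite leq_pmulr ?fact_gt0.
by rewrite expnS factS mulnCA; apply: leq_mul => //; rewrite ltnW.
Qed.

Section Moments.
Variables (R : realType) (y z : nat).
Local Notation T := (sieve_prime y z).

(** The largest of s distinct positive integers is at least s; remove it and induct. *)
Lemma fact_card_le_sprod (r : {set T}) : ((#|r|)`! <= sprod r)%N.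
Proof.
move: {2}#|r| (leqnn #|r|) => n; elim: n r => [|n IH] r.
  by rewrite leqn0 cards_eq0 => /eqP ->; rewrite cards0 /sprod big_set0.
move=> rn; have [->|[p0 p0r]] := set_0Vmem r; first by rewrite cards0 /sprod big_set0.
pose p := [arg max_(q > p0 in r) spval q].
have [pr pmax] : p \in r /\ forall q, q \in r -> (spval q <= spval p)%N.
  by rewrite /p; case: arg_maxnP.
have rp : (#|r| <= spval p)%N.
  rewrite cardE -(size_map (@spval y z)) -(size_iota 1 (spval p)); apply: uniq_leq_size.
    by rewrite map_inj_uniq ?enum_uniq //; apply: spval_inj.
  move=> _ /mapP[q + ->]; rewrite mem_enum mem_iota add1n ltnS => qr.
  by rewrite pmax // prime_gt0 ?spval_prime.
rewrite (cardsD1 p) pr add1n factS /sprod (big_setD1 p) //=.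
apply: leq_mul; first by rewrite (cardsD1 p) pr in rp.
by apply: IH; move: rn; rewrite (cardsD1 p) pr.
Qed.

Lemma harmonic_le (n : nat) : \sum_(i < n) i.+1%:R^-1 <= 1 + ln n.+1%:R :> R.
Proof.
case: n => [|n]; first by rewrite big_ord0 addr_ge0 // ln_ge0 // ler1n.
apply: (@le_trans _ _ (1 + ln n.+1%:R)); last by rewrite lerD2l ler_ln ?posrE ?ltr0n // ler_nat.
elim: n => [|n IH]; first by rewrite big_ord_recr big_ord0 /= add0r invr1 ln1 addr0.
rewrite big_ord_recr /=; apply: le_trans (lerD IH (lexx _)) _.
have e : n.+1%:R / n.+2%:R = 1 + - n.+2%:R^-1 :> R.
  have -> : n.+1%:R = n.+2%:R - 1 :> R by rewrite -[n.+2%:R]natr1 addrK.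
  by rewrite mulrBl divff ?pnatr_eq0 // mul1r.
have : ln (n.+1%:R / n.+2%:R) <= - n.+2%:R^-1 :> R.
  by rewrite e; apply: le_ln1Dx; rewrite ltrN2 invf_lt1 ?ltr0n // ltr1n.
rewrite ln_div ?posrE ?ltr0n //; move: (ln _) (ln _) (_^-1) => u v w; lra.
Qed.

(** From 1/phi(d) <= 2^omega(d)/d, with omega replaced by its maximum over the level set. The
    maximiser r is kept explicit because its product is at most z, which later bounds 2^#|r|. *)
Lemma selberg_sum_upper : (0 < z)%N -> exists2 r : {set T}, slevel r &
  selberg_sum y z R <= 2 ^+ #|r| * (1 + ln z.+1%:R).
Proof.
move=> z0; pose r0 := [arg max_(r > set0 | slevel r) #|(r : {set T})|].
have [r0S r0max] : slevel r0 /\ forall r : {set T}, slevel r -> (#|r| <= #|r0|)%N.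
  by rewrite /r0; case: arg_maxnP => //; apply: slevel0.
exists r0 => //.
apply: (@le_trans _ _ (\sum_(r : {set T} | slevel r) 2 ^+ #|r0| * (sprod r)%:R^-1)).
  apply: ler_sum => r rS; apply: (@le_trans _ _ (2 ^+ #|r| * (sprod r)%:R^-1)).
    rewrite /sphi /sprod natr_prod -!prodfV -prodr_const -big_split /=.
    apply: ler_prod => p _; have p2 := spvalR_ge2 R p; rewrite /spvalR in p2 *.
    have i0 : 0 < (spval p)%:R :> R by apply: lt_le_trans p2.
    have i1 : 0 < (spval p)%:R - 1 :> R by lra.
    by rewrite invr_ge0 ltW //= ler_pdivlMr // mulrC ler_pdivrMr //; lra.
  apply: ler_wpM2r; first by rewrite invr_ge0.
  by apply: ler_weXn2l; [rewrite ler1n | apply: r0max].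
rewrite -mulr_sumr; apply: ler_wpM2l; first by rewrite exprn_ge0.
apply: le_trans (harmonic_le z).
have -> : \sum_(i < z) i.+1%:R^-1 = \sum_(j < z.+1) (j : nat)%:R^-1 :> R.
  by rewrite big_ord_recl /= invr0 add0r.
pose e (r : {set T}) : 'I_z.+1 := inord (sprod r).
rewrite (eq_bigr (fun r => (e r : nat)%:R^-1)); last first.
  by move=> r rS; rewrite inordK.
apply: (@ler_sum_inj _ _ _ (@slevel y z) xpredT e (fun j => (j : nat)%:R^-1)) => // r1 r2.
by rewrite -!topredE /= => s1 s2 /(congr1 val); rewrite /= !inordK // => /sprod_inj.
Qed.

Lemma selberg_nu_upper W n : (0 < z)%N -> selberg_nu y z R W n <=
  selberg_sum y z R * 9 ^+ #|[set p : T | spval p %| W * n + 1]%N|.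
Proof.
move=> z0; apply: ler_wpM2l; first by rewrite ltW // selberg_sum_gt0.
set D := [set p | _]; have -> : 9 ^+ #|D| = (3 ^+ #|D|) ^+ 2 :> R.
  by rewrite exprAC; congr (_ ^+ _); ring.
rewrite -real_normK ?num_real // lerXn2r ?nnegrE ?exprn_ge0 //.
apply: le_trans (ler_norm_sum _ _ _) _.
have -> : 3 ^+ #|D| = \sum_(I : {set T} | I \subset D) 2 ^+ #|I| :> R.
  under [RHS]eq_bigr do rewrite -prodr_const.
  by rewrite sum_subset_prod prodr_const; congr (_ ^+ _); ring.
apply: ler_sum => I _.
exact: (norm_sieve_weight (@spvalR_ge2 y z R) (slevel0 y z0) (@slevelS y z) I).
Qed.

(** Measures the loss from primes dividing a difference h_i - h_j, where the discrepancy is 1/p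
    instead of 1/p^2. *)
Definition sigma (K : R) (n : nat) : R :=
  \prod_(p in [set p : T | spval p %| n]%N) (1 + K * (spval p)%:R^-1).

Lemma card_multiples (n d : nat) : (0 < d)%N ->
  (#|[pred x : 'I_n | (0 < x) && (d %| x)]%N| * d <= n)%N.
Proof.
move=> d0; apply: leq_trans (leq_trunc_div n d); rewrite leq_mul2r; apply/orP; right.
rewrite cardE -(size_map (fun x : 'I_n => x %/ d)%N) -(size_iota 1 (n %/ d)).
apply: uniq_leq_size.
  rewrite map_inj_in_uniq ?enum_uniq // => x1 x2; rewrite !mem_enum !inE.
  move=> /andP[_ d1] /andP[_ d2] e; apply: val_inj; rewrite /= -(divnK d1) -(divnK d2).
  by rewrite e.
move=> _ /mapP[x + ->]; rewrite mem_enum mem_iota !inE add1n ltnS => /andP[x0 dx].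
by rewrite divn_gt0 // dvdn_leq //= leq_div2r // ltnW.
Qed.

(** Expand over squarefree divisors d: at most n/d positive x below n are multiples of d, which
    gives the convergent product of 1 + K/p^2. The point x = 0 is excluded, being divisible by every
    p. *)
Lemma sum_sigma_le (K : R) (n : nat) : (0 < y)%N -> 0 <= K ->
  \sum_(x < n | (0 < x)%N) sigma K x <= n%:R * expR (K / y%:R).
Proof.
move=> y0 K0.
apply: (@le_trans _ _ (n%:R * \prod_(p : T) (1 + K * (spval p)%:R ^- 2))); last first.
  by apply: ler_wpM2l => //; apply: prod_sieve_prime_le.
have f0 (I : {set T}) : 0 <= \prod_(p in I) (K * (spval p)%:R^-1).
  by apply: prodr_ge0 => p _; rewrite mulr_ge0 ?invr_ge0.
have -> : \prod_(p : T) (1 + K * (spval p)%:R ^- 2) =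
    \sum_(I : {set T}) \prod_(p in I) (K * (spval p)%:R^-1) / (sprod I)%:R.
  have <- : \prod_(p in [set: T]) (1 + K * (spval p)%:R ^- 2) = \prod_(p : T) (1 + K * (spval p)%:R ^- 2).
    by apply: eq_bigl => p; rewrite in_setT.
  rewrite -sum_subset_prod; apply: eq_big => [I|I _]; first by rewrite subsetT.
  rewrite /sprod natr_prod -prodf_div; apply: eq_bigr => p _.
  by rewrite -mulrA -invfM expr2.
under eq_bigr do rewrite /sigma -sum_subset_prod big_mkcond.
rewrite exchange_big mulr_sumr; apply: ler_sum => I _ /=.
rewrite -big_mkcondr /= (eq_bigl [pred x : 'I_n | (0 < x) && (sprod I %| x)]%N); last first.
  by move=> x; rewrite /= sprod_dvd.
rewrite sumr_const -[leLHS]mulr_natr mulrCA; apply: ler_wpM2l => //.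
by rewrite ler_pdivlMr ?ltr0n ?sprod_gt0 // -natrM ler_nat card_multiples // sprod_gt0.
Qed.

End Moments.

Lemma exprn_le_expR (R : realType) (x : R) (k : nat) : 0 <= x -> x ^+ k <= k%:R ^+ k * expR x.
Proof.
case: k => [|k] x0; first by rewrite !expr0 mul1r; apply: le_trans (expR_ge1Dx x); rewrite lerDl.
have k0 : (0 : R) < k.+1%:R by rewrite ltr0n.
have h : x / k.+1%:R <= expR (x / k.+1%:R) by apply: le_trans (expR_ge1Dx _); rewrite lerDr.
have : (x / k.+1%:R) ^+ k.+1 <= expR (x / k.+1%:R) ^+ k.+1.
  by apply: lerXn2r; rewrite ?nnegrE ?expR_ge0 // divr_ge0 // ltW.
rewrite -expRM_natr mulfVK ?gt_eqF // expr_div_n ler_pdivrMr ?exprn_gt0 //.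
by rewrite mulrC.
Qed.

(** Says that nu is N^o(1) pointwise, which makes the large value of [tau] at 0 affordable. *)
Lemma selberg_nu_power (R : realType) (n : nat) : exists2 C : R, 0 <= C &
  forall y z N W x, (0 < z < N)%N -> (W * x + 1 <= N ^ 2)%N ->
    selberg_nu y z R W x ^+ n <= C * N%:R.
Proof.
(* The k-th powers of 2^omega, of the logarithm and of 9^omega are O(N), O(N) and O(N^2); the fourth
   root of the product N^4 is N. *)
pose k := (4 * n)%N; pose A : nat := ((2 ^ k) ^ (2 ^ k))%N; pose D : nat := ((9 ^ k) ^ (9 ^ k))%N.
pose E : R := A%:R * (k%:R ^+ k * expR 1) * D%:R.
have E0 : 0 <= E by rewrite !mulr_ge0 ?exprn_ge0 ?expR_ge0.
exists (1 + E); first by rewrite addr_ge0.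
move=> y z N W x /andP[z0 zN] WN.
have N0 : (0 < N)%N by apply: leq_trans zN.
have [r rS Gr] := selberg_sum_upper R y z0.
set H := 1 + ln z.+1%:R in Gr.
have H0 : 0 <= H by rewrite addr_ge0 // ln_ge0 // ler1n.
set s := #|[set p : sieve_prime y z | spval p %| W * x + 1]%N|.
have nu_le : selberg_nu y z R W x <= 2 ^+ #|r| * H * 9 ^+ s.
  by apply: le_trans (selberg_nu_upper R y W x z0) _; apply: ler_wpM2r; rewrite ?exprn_ge0.
have nu0 := selberg_nu_ge0 y R z0 W x.
have aA : (2 ^+ #|r|) ^+ k <= A%:R * N%:R :> R.
  rewrite -exprM mulnC exprM -!natrX -natrM ler_nat.
  apply: leq_trans (expn_le_fact (2 ^ k) #|r|) _; apply: leq_mul => //.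
  apply: leq_trans (fact_card_le_sprod r) _; apply: leq_trans rS _; exact: ltnW.
have dD : (9 ^+ s) ^+ k <= D%:R * N%:R ^+ 2 :> R.
  rewrite -exprM mulnC exprM -!natrX -natrM ler_nat.
  apply: leq_trans (expn_le_fact (9 ^ k) s) _; apply: leq_mul => //.
  apply: leq_trans (fact_card_le_sprod _) _; apply: leq_trans WN.
  by apply: dvdn_leq; [rewrite addn1 | rewrite sprod_dvd].
have hH : H ^+ k <= k%:R ^+ k * expR 1 * N%:R.
  apply: le_trans (exprn_le_expR k H0) _; rewrite -mulrA; apply: ler_wpM2l; rewrite ?exprn_ge0 //.
  rewrite expRD lnK ?posrE ?ltr0n //; apply: ler_wpM2l; rewrite ?expR_ge0 // ler_nat //.
rewrite -(@ler_pXn2r _ 4) ?nnegrE ?mulr_ge0 ?exprn_ge0 ?addr_ge0 //.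
rewrite -exprM mulnC -/k.
apply: (@le_trans _ _ ((2 ^+ #|r| * H * 9 ^+ s) ^+ k)).
  by apply: lerXn2r => //; rewrite nnegrE ?nu0 // !mulr_ge0 ?exprn_ge0.
rewrite !exprMn.
apply: (@le_trans _ _ (E * N%:R ^+ 4)).
  apply: (@le_trans _ _ ((A%:R * N%:R) * (k%:R ^+ k * expR 1 * N%:R) * (D%:R * N%:R ^+ 2))).
    by rewrite !ler_pM ?mulr_ge0 ?exprn_ge0.
  by rewrite le_eqVlt /E; apply/orP; left; apply/eqP; ring.
apply: ler_wpM2r; rewrite ?exprn_ge0 //.
apply: (@le_trans _ _ (1 + E)); first by rewrite lerDr.
by apply: ler_eXnr => //; rewrite lerDl.
Qed.

(** * Choice of the level and of the cutoff *)

Lemma near_prime_ooP (P : nat -> Prop) :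
  (\forall N \near prime_oo, P N) <->
  exists n0, forall N, (n0 <= N)%N -> prime N -> P N.
Proof.
split=> [[n0 _ h]|[n0 h]]; first by exists n0 => N n0N pN; apply: h.
by exists n0 => // N /= n0N pN; apply: h.
Qed.

Section Level.
Variables (R : realType) (E : nat).
Hypothesis E0 : (0 < E)%N.

(** A power of 2 within a factor 2 of N^(1/E), avoiding real roots. *)
Definition sieve_level (N : nat) : nat := (2 ^ (trunc_log 2 N %/ E))%N.

Lemma sieve_level_gt0 N : (0 < sieve_level N)%N.
Proof. by rewrite expn_gt0. Qed.

Lemma sieve_level_expn_le N : (0 < N)%N -> (sieve_level N ^ E <= N)%N.
Proof.
move=> N0; rewrite -expnM; apply: leq_trans (trunc_logP (ltnSn 1) N0).
by rewrite leq_exp2l // leq_trunc_div.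
Qed.

Lemma ltn_sieve_level N : (N < 2 ^ E * sieve_level N ^ E)%N.
Proof.
apply: leq_trans (trunc_log_ltn N (ltnSn 1)) _.
by rewrite -expnM -expnD leq_exp2l // addnC -mulSnr ltn_ceil.
Qed.

Lemma sieve_level_ge b N : (2 ^ (E * b) <= N)%N -> (b <= sieve_level N)%N.
Proof.
move=> bN; apply: ltnW; apply: leq_trans (ltn_expl b (ltnSn 1)) _.
rewrite leq_exp2l // leq_divRL // mulnC; apply: trunc_log_max => //.
Qed.

(** The slowly growing bound on w. The factorial bounds the primorial, so W <= N^(1/4); the second
    condition keeps the cutoff below the sieve level. *)
Definition max_cutoff (N : nat) : nat :=
  (\max_(y < N | (y`! ^ 4 <= N) && (y <= sieve_level N)) y)%N.

Lemma max_cutoffP N : (0 < N)%N ->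
  ((max_cutoff N)`! ^ 4 <= N)%N && (max_cutoff N <= sieve_level N)%N.
Proof.
move=> N0; rewrite /max_cutoff.
elim/big_ind: _ => [|a b Pa Pb|//]; first by rewrite fact0 exp1n N0 /=.
by rewrite /maxn; case: ifP.
Qed.

Lemma near_max_cutoff_ge (A : R) : \forall N \near prime_oo, A <= (max_cutoff N)%:R.
Proof.
apply/near_prime_ooP.
pose b := (Num.truncn A).+1.
exists (b`! ^ 4 + 2 ^ (E * b) + b.+1)%N => N bN _.
apply: (@le_trans _ _ b%:R); first by rewrite ltW // truncnS_gt.
have bltN : (b < N)%N by lia.
rewrite ler_nat /max_cutoff; apply: (@leq_bigmax_cond _ _ _ (Ordinal bltN)).
apply/andP; split=> /=; first by lia.
by apply: sieve_level_ge; lia.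
Qed.

Record sieve_params (b N y : nat) : Prop := SieveParams {
  params_y : (b <= y)%N;
  params_z : (b <= sieve_level N)%N;
  params_N : (b <= N)%N;
  params_yz : (y <= sieve_level N)%N;
  params_W : (primorialn y ^ 4 <= N)%N }.

Lemma near_sieve_params (w : nat -> R) (b : nat) :
  (forall A, \forall N \near prime_oo, A <= w N) ->
  (\forall N \near prime_oo, w N <= (max_cutoff N)%:R) ->
  \forall N \near prime_oo, sieve_params b N (Num.truncn (w N)).
Proof.
move=> /(_ b%:R)/near_prime_ooP[n1 h1] /near_prime_ooP[n2 h2].
apply/near_prime_ooP; exists (n1 + n2 + 2 ^ (E * b) + b)%N => N nN pN.
have {}h1 : b%:R <= w N by apply: h1 => //; lia.
have {}h2 : w N <= (max_cutoff N)%:R by apply: h2 => //; lia.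
have /andP[c1 c2] := max_cutoffP (prime_gt0 pN).
have yc : (Num.truncn (w N) <= max_cutoff N)%N.
  rewrite -(ler_nat R); apply: le_trans h2; rewrite truncn_le.
  by rewrite (le_trans _ h1).
split=> //.
- by rewrite truncn_ge_nat // (le_trans _ h1).
- by apply: sieve_level_ge; lia.
- by lia.
- exact: leq_trans c2.
- apply: leq_trans c1; rewrite leq_exp2r //.
  apply: leq_trans (primorialn_le_fact _) _.
  by apply: leq_fact.
Qed.

End Level.

(** * Linear forms and translates *)

Lemma intr_Fp_neq0 (p : nat) (a : int) : prime p -> a != 0 -> (`|a| < p)%N -> a%:~R != 0 :> 'F_p.
Proof.
move=> pp a0 ap; have ap' : ~~ (p %| `|a|)%N.
  by apply/negP => /dvdn_leq; rewrite absz_gt0 a0 => /(_ isT); rewrite leqNgt ap.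
case: a a0 ap ap' => n a0 ap ap'; first by rewrite -pmulrn natr_Fp_eq0.
by rewrite NegzE rmorphN oppr_eq0 /= -pmulrn natr_Fp_eq0.
Qed.

Section IntegralForms.
Variables (k m t : nat) (L : 'M[rat]_(m, t)).

(** The matrix k! L: shifting x by k! h moves the forms by integers, without changing the forms
    themselves. *)
Definition clear_denominators : 'M[int]_(m, t) :=
  \matrix_(i, j) (numq (L i j) * (k`! %/ `|denq (L i j)|)%N%:Z).

Local Notation A := clear_denominators.
Hypothesis L_adm : admissible_coefs k L.

Let L_bounds i j : [/\ `|numq (L i j)| <= k%:Z, (0 < `|denq (L i j)| <= k)%N &
   (denq (L i j) = `|denq (L i j)|%N :> int)].
Proof.
have [/(_ i j)[h1 h2] _ _] := L_adm; have d0 := denq_gt0 (L i j).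
split=> //; last by rewrite gtz0_abs.
by rewrite absz_gt0 denq_neq0 -lez_nat abszE h2.
Qed.

Lemma clear_denominatorsE i j : A i j * denq (L i j) = k`!%:Z * numq (L i j).
Proof.
have [_ h2 ->] := L_bounds i j; rewrite mxE -mulrA -PoszM divnK; last exact: dvdn_fact.
by rewrite mulrC.
Qed.

Lemma clear_denominators_le i j : `|A i j| <= (k`! * k)%N%:Z.
Proof.
have [h1 h2 _] := L_bounds i j; rewrite mxE normrM mulrC PoszM.
by apply: ler_pM => //; rewrite ger0_norm // lez_nat leq_div.
Qed.

Lemma clear_denominators_rat i j : (A i j)%:~R = k`!%:R * L i j.
Proof.
rewrite -[L i j in RHS]divq_num_den mulrA; apply/(canRL (mulfK _)).
  by rewrite intr_eq0 denq_neq0.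
by rewrite -intrM clear_denominatorsE intrM -pmulrn.
Qed.

Lemma clear_denominators_row_neq0 i : exists j, A i j != 0.
Proof.
have [_ /(_ i)/rV0Pn[j Lj] _] := L_adm; exists j.
rewrite -(intr_eq0 rat) clear_denominators_rat mulf_eq0 negb_or.
by rewrite pnatr_eq0 -lt0n fact_gt0 /=; rewrite mxE in Lj.
Qed.

Lemma clear_denominators_minor i i' : i != i' ->
  exists j, exists j', A i j * A i' j' - A i j' * A i' j != 0.
Proof.
move=> ii'; have [_ hrow hcol] := L_adm.
have /rV0Pn[j'] := hrow i'; rewrite mxE => Lj'.
have := hcol i i' ii' (L i j' / L i' j').
move=> /eqP/rowP/eqfunP; rewrite negb_forall => /existsP[j].
rewrite !mxE => Lj; exists j, j'; rewrite -(intr_eq0 rat) rmorphB !rmorphM /=.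
rewrite !clear_denominators_rat.
have k0 : k`!%:R != 0 :> rat by rewrite pnatr_eq0 -lt0n fact_gt0.
rewrite mulrACA [X in _ - X]mulrACA -mulrBr mulf_neq0 ?mulf_neq0 // subr_eq0.
apply: contra Lj => /eqP e; apply/eqP; apply: (mulIf Lj'); rewrite e.
by field.
Qed.

Lemma clear_denominators_ratr (N : nat) i j : prime N -> (k < N)%N ->
  ratr (L i j) * k`!%:R = (A i j)%:~R :> 'F_N.
Proof.
move=> pN kN; have [_ /andP[d0 dk] _] := L_bounds i j.
have dN : (denq (L i j))%:~R != 0 :> 'F_N.
  by apply: intr_Fp_neq0; rewrite ?denq_neq0 // (leq_ltn_trans dk).
apply: (mulIf dN); rewrite -intrM clear_denominatorsE intrM -pmulrn.
by rewrite /ratr mulrAC mulrVK ?unitfE // mulrC.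
Qed.

End IntegralForms.

(** The integral coefficients are at most k! k, so their 2 by 2 minors are at most 2 (k! k)^2;
    beyond this threshold non-zero coefficients and minors stay non-zero modulo every sieve prime,
    and coefficients modulo N. *)
Lemma expect_prod_affine_forms (R : realType) (k N y z m t : nat) (L : 'M[rat]_(m, t))
    (b : 'I_m -> 'F_N) :
  prime N -> (0 < y <= z)%N -> (2 * (k`! * k) ^ 2 < y)%N -> (2 * (k`! * k) ^ 2 < N)%N ->
  (k < N)%N -> admissible_coefs k L ->
  `|expect (fun x : 'rV['F_N]_t =>
      \prod_i selberg_nu y z R (primorialn y) (affine_form L b i x)) - 1| <=
  expR (16 ^+ m / y%:R) - 1 + (2 * m * (t * (k`! * k)))%:R * z.+1%:R ^+ (7 * m) / N%:R.
Proof.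
move=> pN /andP[y0 yz] yB NB kN Ladm.
pose A := clear_denominators k L.
have A_le := clear_denominators_le Ladm.
have A_abs i j : (`|A i j| <= k`! * k)%N by rewrite -lez_nat abszE; apply: A_le.
have z0 : (0 < z)%N by apply: leq_trans yz.
have Bsq : (k`! * k <= (k`! * k) ^ 2)%N by rewrite -mulnn; case: (k`! * k)%N => // n; rewrite leq_pmulr.
have shift (h : 'I_t -> nat) : exists2 s : 'rV['F_N]_t -> 'rV['F_N]_t, injective s &
    forall i x, affine_form L b i (s x) = affine_form L b i x + (\sum_j A i j * (h j)%:Z)%:~R.
  exists (fun x => x + \row_j (k`!%:R * (h j)%:R)) => [|i x]; first exact: addIr.
  rewrite /affine_form [RHS]addrAC; congr (_ + _).
  rewrite rmorph_sum -big_split; apply: eq_bigr => j _ /=.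
  rewrite mxE [X in _ * (_ + X)]mxE mulrDr mulrA clear_denominators_ratr // rmorphM /=.
  by rewrite -[X in _ = _ + _ * X]pmulrn.
have equi i (c : 'F_N) : (#|[set x | affine_form L b i x == c]| * N <= #|{: 'rV['F_N]_t}|)%N.
  have [j Aij] := clear_denominators_row_neq0 Ladm i.
  pose a : 'M['F_N]_(t, 1) := \col_j ratr (L i j).
  have aj : a j 0 != 0.
    have lt : (`|A i j| < N)%N by apply: leq_ltn_trans (A_abs i j) _; lia.
    have := intr_Fp_neq0 pN Aij lt.
    by rewrite -(clear_denominators_ratr Ladm i j pN kN) mulf_eq0 negb_or mxE => /andP[].
  have fa : row_full a.
    apply/row_fullP; exists ((a j 0)^-1 *: delta_mx 0 j).
    by apply/matrixP => u v; rewrite -scalemxAl -rowE mxE [row _ _ _ _]mxE [RHS]mxE !ord1 mulVf.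
  have := card_linear_fiber (const_mx (c - b i)) fa.
  rewrite card_mx card_Fp // mul1n expn1 => <-; rewrite leq_mul2r; apply/orP; right.
  apply: subset_leq_card; apply/subsetP => x; rewrite !inE /affine_form => /eqP <-.
  apply/eqP/matrixP => u v; rewrite !ord1 !mxE addrK; apply: eq_bigr => l _.
  by rewrite mxE mulrC.
have X0 : (0 < #|{: 'rV['F_N]_t}|)%N by apply/card_gt0P; exists 0.
have close (x : 'rV['F_N]_t) (p : sieve_prime y z) (Q : {set 'I_m}) :
   `|local_density R (primorialn y) A (spval p) (base (affine_form L b) x) Q
     - spvalR R p ^- #|Q| | <= (spval p)%:R ^- 2.
  have pp := spval_prime p; have yp := spval_gt p.
  have Wp : ~~ (spval p %| primorialn y)%N by rewrite dvdn_primorialn // -ltnNge.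
  apply: local_density_close => // [i|i i' ii'].
    have [j Aij] := clear_denominators_row_neq0 Ladm i; exists j.
    by apply: intr_Fp_neq0 => //; apply: leq_ltn_trans (A_abs i j) _; lia.
  have [j [j' minor]] := clear_denominators_minor Ladm ii'.
  apply: (@local_density2 _ _ _ _ _ _ _ pp Wp _ _ j j').
  apply: intr_Fp_neq0 => //; rewrite -/A in minor *.
  have a1 := A_abs i j; have a2 := A_abs i' j'; have a3 := A_abs i j'; have a4 := A_abs i' j.
  have m1 := leq_mul a1 a2; have m2 := leq_mul a3 a4.
  have : (`|(A i j * A i' j' - A i j' * A i' j)%R| <= `|A i j| * `|A i' j'| + `|A i j'| * `|A i' j|)%N.
    by rewrite -!abszM; lia.
  by rewrite -mulnn in yB; lia.
apply: le_trans (expect_prod_selberg pN A_le shift equi z0 X0 close) _.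
rewrite lerD2r lerB //.
by apply: le_trans (prod_sieve_prime_le z y0 _) _; rewrite ?exprn_ge0.
Qed.

(** Bounds the product by a power of its largest factor. This turns a product over pairs (i, j) into
    the sum over pairs that the correlation condition requires. *)
Lemma prod_le_sum_expn (R : realType) (I : finType) (P : pred I) (g : I -> R) (n : nat) :
  (exists i, P i) -> (#|P| <= n)%N -> (forall i, 1 <= g i) ->
  \prod_(i | P i) g i <= \sum_(i | P i) g i ^+ n.
Proof.
move=> [i0 Pi0] Pn g1; pose i := [arg max_(j > i0 | P j) g j]%O.
have [Pi gi] : P i /\ forall j, P j -> g j <= g i.
  by rewrite /i; case: arg_maxP.
have g0 j : 0 <= g j by apply: le_trans (g1 j).
apply: (@le_trans _ _ (\prod_(j | P j) g i)).
  by apply: ler_prod => j Pj; rewrite g0 gi.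
rewrite prodr_const (bigD1 i Pi) /=; apply: (@le_trans _ _ (g i ^+ n)).
  by rewrite ler_weXn2l.
by rewrite lerDl sumr_ge0 // => j _; rewrite exprn_ge0.
Qed.

Lemma sum_neq_ord (V : nmodType) (m : nat) (F : 'I_m -> 'I_m -> V) :
  \sum_(ij : 'I_m * 'I_m | ij.1 != ij.2) F ij.1 ij.2 =
  \sum_(i < m) \sum_(j < m | (i < j)%N) (F i j + F j i).
Proof.
rewrite -(pair_big_dep xpredT (fun i j => i != j) F) /=.
have -> : \sum_i \sum_(j | i != j) F i j =
    \sum_(i < m) \sum_(j < m | (i < j)%N) F i j + \sum_(i < m) \sum_(j < m | (j < i)%N) F i j.
  rewrite -big_split; apply: eq_bigr => i _ /=.
  rewrite (bigID (fun j : 'I_m => (i < j)%N)) /=; congr (_ + _); apply: eq_bigl => j.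
    by rewrite -val_eqE /=; case: ltngtP.
  by rewrite -val_eqE /=; case: ltngtP.
rewrite [X in _ + X](exchange_big_dep xpredT) //= -big_split.
by apply: eq_bigr => i _; rewrite -big_split.
Qed.

(** * Correlations of translates *)

Section Translates.
Variables (R : realType) (N y z m : nat) (h : 'I_m -> 'F_N).
Hypotheses (pN : prime N) (y0 : (0 < y)%N) (yz : (y <= z)%N) (m1 : (1 < m)%N).
Local Notation T := (sieve_prime y z).
Local Notation K := (16 ^+ m : R).
Local Notation W := (primorialn y).
Local Notation s x := (sigma y z K (nat_of_ord x) ^+ (m * m)).

Lemma sigma_ge1 n : 1 <= sigma y z K n.
Proof.
rewrite /sigma; elim/big_ind: _ => // [a b a1 b1|p _]; first exact: mulr_ege1.
by rewrite lerDl mulr_ge0 ?invr_ge0 ?exprn_ge0.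
Qed.

Lemma subFp_nat (a b : 'F_N) : (b <= a)%N -> nat_of_ord (a - b)%R = (a - b)%N.
Proof.
move=> ba; rewrite -{1}(natr_Zp a) -{1}(natr_Zp b) -natrB // val_Fp_nat // modn_small //.
by apply: leq_ltn_trans (leq_subr _ _) _; rewrite -[X in (_ < X)%N](Fp_cast pN) ltn_ord.
Qed.

(** Both orders of a pair count: h_i - h_j and h_j - h_i have different representatives in [0, N),
    and which of them is the difference of the integers x + h_i and x + h_j depends on x. *)
Let close_p (p : nat) := [exists ij : 'I_m * 'I_m,
  (ij.1 != ij.2) && (p %| nat_of_ord (h ij.1 - h ij.2)%R)%N].
Let d (p : T) : R := if close_p (spval p) then (spval p)%:R^-1 else (spval p)%:R ^- 2.

Lemma translates_local_density (x : 'F_N) (p : T) (Q : {set 'I_m}) :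
  `|local_density R W (const_mx 1 : 'M[int]_(m, 1)) (spval p) (base (fun i x => x + h i) x) Q
     - spvalR R p ^- #|Q| | <= d p.
Proof.
have pp := spval_prime p; have yp := spval_gt p.
have Wp : ~~ (spval p %| W)%N by rewrite dvdn_primorialn // -ltnNge.
have p1 : (1 : R) <= (spval p)%:R by rewrite ler1n prime_gt0.
have nz i : exists j, ((const_mx 1 : 'M[int]_(m, 1)) i j)%:~R != 0 :> 'F_(spval p).
  by exists 0; rewrite mxE oner_neq0.
apply: local_density_close => // [i i' ii'|]; last first.
  rewrite /d; case: ifP => // _; rewrite lef_pV2 ?posrE ?exprn_gt0 ?(lt_le_trans ltr01) //.
  by rewrite expr2 ler_peMl // (le_trans ler01).
rewrite /d; case: ifP => [_|/negbT/existsPn np].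
  rewrite -(local_density1 R (base (fun i x => x + h i) x) pp Wp (nz i)).
  by apply: local_densityS; rewrite sub1set set21.
(* If p divides no such difference, two of the conditions are incompatible modulo p, so the density
   is 0. *)
rewrite /local_density expect_indicator (eq_card0 (A := _)) ?mul0r ?invr_ge0 ?exprn_ge0 //.
move=> v; rewrite -topredE /=; apply/negbTE/negP => /forallP hv.
wlog ii'_le : i i' ii' hv / (base (fun i x => (x + h i)%R) x i' <= base (fun i x => (x + h i)%R) x i)%N.
  move=> wl; have [le|/ltnW le] := leqP (base (fun i x => x + h i) x i') (base (fun i x => x + h i) x i).
    exact: (wl i i').
  by apply: (wl i' i) => //; [rewrite eq_sym|rewrite setUC].
have := hv i; have := hv i'; rewrite set21 set22 /= !root_condE // !big_ord1 !mxE.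
move=> /eqP -> /eqP /addrI /oppr_inj /eqP.
rewrite eq_sym -subr_eq0 -natrB // natr_Fp_eq0 // /base -subFp_nat // opprD addrACA subrr add0r => pd.
by have := np (i, i'); rewrite /= ii' pd.
Qed.

(** A factor 1 + K/p is absorbed by [sigma] at a pair whose difference p divides, the other factors
    by the convergent product. The exponent m * m bounds the number of ordered pairs. *)
Lemma prod_translates_le : \prod_p (1 + K * d p) <=
  expR (K / y%:R) * \sum_(i < m) \sum_(j < m | (i < j)%N) (s (h i - h j) + s (h j - h i)).
Proof.
have K0 : 0 <= K by rewrite exprn_ge0.
pose g (ij : 'I_m * 'I_m) : R := sigma y z K (nat_of_ord (h ij.1 - h ij.2)).
rewrite -(sum_neq_ord (fun i j => s (h i - h j))).
apply: (@le_trans _ _ (expR (K / y%:R) * \prod_(ij : 'I_m * 'I_m | ij.1 != ij.2) g ij)); last first.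
  apply: ler_wpM2l; first exact: expR_ge0.
  apply: (@prod_le_sum_expn _ _ _ g); last by move=> ij; apply: sigma_ge1.
    exists (Ordinal (ltnW m1), Ordinal m1) => //.
  by apply: leq_trans (max_card _) _; rewrite card_prod card_ord.
apply: le_trans (ler_wpM2r _ (prod_sieve_prime_le z y0 K0)); last first.
  by apply: prodr_ge0 => ij _; apply: le_trans (sigma_ge1 _).
rewrite /g /sigma.
under [X in _ <= _ * X]eq_bigr do rewrite big_mkcond.
rewrite exchange_big -big_split /=; apply: ler_prod => p _.
have i0 : 0 <= (spval p)%:R^-1 :> R by rewrite invr_ge0.
have d0 : 0 <= d p by rewrite /d; case: ifP; rewrite // invr_ge0 exprn_ge0.
have one (ij : 'I_m * 'I_m) :
   1 <= if p \in [set p0 : T | spval p0 %| nat_of_ord (h ij.1 - h ij.2)%R]%N then 1 + K * (spval p)%:R^-1 else 1.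
  by case: ifP => // _; rewrite lerDl mulr_ge0.
rewrite addr_ge0 ?mulr_ge0 //= /d; case: ifP => [/existsP[ij /andP[ij1 ij2]]|_].
  rewrite (bigD1 ij) //= inE ij2 mulrA.
  apply: (@le_trans _ _ ((1 + K * (spval p)%:R ^- 2) * (1 + K * (spval p)%:R^-1))).
    by rewrite ler_peMl ?lerDl ?mulr_ge0 ?addr_ge0 // invr_ge0 exprn_ge0.
  apply: ler_peMr; first by rewrite mulr_ge0 ?addr_ge0 ?mulr_ge0 ?invr_ge0 ?exprn_ge0.
  by elim/big_ind: _ => [//|a b a1 b1|ij' _]; [apply: mulr_ege1 | apply: one].
apply: ler_peMr; first by rewrite addr_ge0 ?mulr_ge0 ?invr_ge0 ?exprn_ge0.
by elim/big_ind: _ => [//|a b a1 b1|ij' _]; [apply: mulr_ege1 | apply: one].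
Qed.

Theorem expect_prod_translates :
  expect (fun x : 'F_N => \prod_i selberg_nu y z R W (x + h i)%R) <=
  expR K * \sum_(i < m) \sum_(j < m | (i < j)%N) (s (h i - h j) + s (h j - h i)) +
  (2 * m)%:R * z.+1%:R ^+ (7 * m) / N%:R.
Proof.
have z0 : (0 < z)%N by apply: leq_trans yz.
pose A : 'M[int]_(m, 1) := const_mx 1.
pose psi i (x : 'F_N) := x + h i.
have A_le i j : `|A i j| <= 1%N%:Z by rewrite mxE.
have shift (u : 'I_1 -> nat) : exists2 s : 'F_N -> 'F_N, injective s &
    forall i x, psi i (s x) = psi i x + (\sum_j A i j * (u j)%:Z)%:~R.
  exists (fun x => x + (u 0)%:R) => [|i x]; first exact: addIr.
  by rewrite /psi big_ord1 mxE mul1r -pmulrn addrAC.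
have equi i (c : 'F_N) : (#|[set x | psi i x == c]| * N <= #|{: 'F_N}|)%N.
  rewrite card_Fp // (_ : [set x | _] = [set c - h i]) ?cards1 ?mul1n //.
  by apply/setP => x; rewrite !inE eq_sym -subr_eq eq_sym.
have X0 : (0 < #|{: 'F_N}|)%N by apply/card_gt0P; exists 0.
have := expect_prod_selberg pN A_le shift equi z0 X0 translates_local_density.
rewrite ler_norml => /andP[_]; rewrite lerBlDr => H.
apply: le_trans H _.
rewrite addrAC subrK mul1n muln1 lerD2r.
apply: le_trans prod_translates_le _; apply: ler_wpM2r.
  apply: sumr_ge0 => i _; apply: sumr_ge0 => j _.
  by apply: addr_ge0; rewrite exprn_ge0 // (le_trans ler01 (sigma_ge1 _)).
rewrite ler_expR ler_pdivrMr ?ltr0n // ler_peMr ?exprn_ge0 // ler1n //.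
Qed.

End Translates.

(** * The pseudorandom majorant *)

(** As z + 1 <= z^2, the claim follows from z^(14m + 1) <= z^(32 m0) <= N. *)
Lemma level_error_le (R : realType) (m m0 N : nat) : (0 < m0)%N -> (m <= m0)%N ->
  (1 < sieve_level (32 * m0) N)%N -> (0 < N)%N ->
  (sieve_level (32 * m0) N).+1%:R ^+ (7 * m) / N%:R <= (sieve_level (32 * m0) N)%:R^-1 :> R.
Proof.
move=> m0_gt0 mm z1 N0; have zN := sieve_level_expn_le (32 * m0) N0.
move: z1 zN; set z := sieve_level _ _ => z1 zN.
have z0 : (0 < z)%N by apply: ltnW.
rewrite ler_pdivrMr ?ltr0n // mulrC ler_pdivlMr ?ltr0n // -natrX -natrM ler_nat.
apply: leq_trans zN; apply: (@leq_trans ((z ^ 2) ^ (7 * m) * z)).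
  rewrite leq_mul2r; apply/orP; right.
  have [->|m_gt0] := posnP (7 * m); first by rewrite !expn0.
  by rewrite leq_exp2r // -mulnn; apply: leq_trans (leq_mul z1 (leqnn z)); lia.
by rewrite -expnM -expnSr leq_exp2l //; lia.
Qed.

(** Fourth powers: (WN)^4 <= N^5 < (2z)^(5e), and 2^5 <= z^3 for z >= 4 turns this into z^(8e). *)
Lemma level_dominates (z W N e : nat) : (4 <= z)%N -> (0 < e)%N ->
  (W ^ 4 <= N)%N -> (N < 2 ^ e * z ^ e)%N -> (W * N <= z ^ (2 * e))%N.
Proof.
move=> z4 e0 WN Nz.
rewrite -(@leq_exp2r _ _ 4) // expnMn -expnM.
apply: (@leq_trans (N ^ 5)); first by rewrite [(N ^ 5)%N]expnS leq_mul2r WN orbT.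
apply: (@leq_trans ((2 ^ e * z ^ e) ^ 5)); first by rewrite leq_exp2r // ltnW.
rewrite expnMn -!expnM (_ : 2 * e * 4 = e * 3 + e * 5)%N; last by lia.
rewrite expnD leq_mul2r; apply/orP; right.
rewrite [(e * 5)%N]mulnC expnM [(e * 3)%N]mulnC expnM leq_exp2r //.
by apply: (@leq_trans (4 ^ 3)) => //; rewrite leq_exp2r.
Qed.

Lemma expR_div_nat_small (R : realType) (K e : R) : 0 <= K -> 0 < e ->
  exists b : nat, forall y, (b <= y)%N -> expR (K / y%:R) - 1 <= e.
Proof.
move=> K0 e0; have l0 : 0 < ln (1 + e) by apply: ln_gt0; rewrite ltrDl.
exists (Num.truncn (K / ln (1 + e))).+1 => y ly.
have y0 : (0 : R) < y%:R by rewrite ltr0n (leq_trans _ ly).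
rewrite lerBlDl -[leRHS]lnK ?posrE ?addr_gt0 // ler_expR ler_pdivrMr // mulrC.
rewrite -ler_pdivrMr //; apply: le_trans (ltW (truncnS_gt _)) _.
by rewrite ler_nat.
Qed.

Lemma exprD_le (R : realType) (a b : R) (n : nat) : 0 <= a -> 0 <= b ->
  (a + b) ^+ n <= 2 ^+ n * (a ^+ n + b ^+ n).
Proof.
move=> a0 b0; wlog ab : a b a0 b0 / a <= b.
  by move=> wl; have [|/ltW] := leP a b; [apply: wl | rewrite addrC [X in _ * X]addrC; apply: wl].
apply: (@le_trans _ _ ((2 * b) ^+ n)).
  by apply: lerXn2r; rewrite ?nnegrE ?addr_ge0 ?mulr_ge0 //; lra.
by rewrite exprMn; apply: ler_wpM2l; rewrite ?exprn_ge0 // lerDr exprn_ge0.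
Qed.

(** Convexity on [0, 1]. It bounds a power of [sigma] by [sigma] with a larger constant, so all
    moments reduce to the first. *)
Lemma expr1D_le (R : realType) (K a : R) (n : nat) : 0 <= K -> 0 <= a <= 1 ->
  (1 + K * a) ^+ n <= 1 + (1 + K) ^+ n * a.
Proof.
move=> K0 /andP[a0 a1].
suff : (1 + K * a) ^+ n <= 1 + ((1 + K) ^+ n - 1) * a.
  by move=> h; apply: le_trans h _; rewrite mulrBl mul1r addrA lerBlDr lerDl.
elim: n => [|n IH]; first by rewrite !expr0 subrr mul0r addr0.
have c0 : 0 <= (1 + K) ^+ n - 1 by rewrite subr_ge0 exprn_ege1 // lerDl.
rewrite exprS; apply: le_trans (ler_wpM2l _ IH) _.
  by rewrite addr_ge0 ?mulr_ge0.
rewrite [in leRHS]exprS; set c := (1 + K) ^+ n in c0 *.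
have : 0 <= K * (c - 1) * a * (1 - a) by rewrite !mulr_ge0 // subr_ge0.
by move=> h; rewrite -subr_ge0; apply: le_trans h _; rewrite le_eqVlt; apply/orP; left; apply/eqP; ring.
Qed.

Section Final.
Variables (R : realType) (k : nat) (w : nat -> R).
Hypothesis k3 : (3 <= k)%N.
Local Notation m0 := (k * 2 ^ k.-1)%N.
(* The level z = N^(1 / E) is small enough for the error z^(7 m0) / N to vanish, and
   2 E is the reciprocal of the constant in the majorisation. *)
Local Notation E := (32 * m0)%N.
Local Notation lev N := (sieve_level E N).
Local Notation cut N := (Num.truncn (w N)).
Hypothesis w_oo : forall A, \forall N \near prime_oo, A <= w N.
Hypothesis w_le : \forall N \near prime_oo, w N <= (max_cutoff E N)%:R.

Definition sieve_measure : ZN_family R :=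
  fun N x => selberg_nu (cut N) (lev N) R (primorialn (cut N)) x.
Arguments sieve_measure : clear implicits.

Lemma m0_gt0 : (0 < m0)%N. Proof. by rewrite muln_gt0 expn_gt0 andbT; lia. Qed.

Lemma near_params b : exists n0, forall N, (n0 <= N)%N -> prime N ->
  sieve_params E b N (cut N).
Proof.
apply/near_prime_ooP; apply: near_sieve_params => //.
by rewrite muln_gt0 m0_gt0.
Qed.

Lemma sieve_measure_ge0 N x : 0 <= sieve_measure N x.
Proof. by apply: selberg_nu_ge0; apply: sieve_level_gt0. Qed.

Lemma sieve_measure_linear_forms : linear_forms_condition m0 (3 * k - 4) k sieve_measure.
Proof.
move=> e e0; have e2 : 0 < e / 2 by rewrite divr_gt0.
have [b1 hb1] := expR_div_nat_small (exprn_ge0 m0 (ler0n R 16)) e2.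
pose B := (k`! * k)%N; pose C : nat := (2 * m0 * ((3 * k - 4) * B))%N.
pose b2 := (Num.truncn (C%:R / (e / 2))).+1.
(* [b1] makes the exponential error small, [b2] the wrap-around error C/z, and the rest secures the
   size conditions on coefficients and minors. *)
pose b := (b1 + b2 + 2 * B ^ 2 + k + 2)%N.
have [n0 hn0] := near_params b.
apply/near_prime_ooP; exists n0 => N nN pN m t L c mm tt Ladm.
have [py pz pN' pyz pW] := hn0 N nN pN.
have y0 : (0 < cut N)%N by lia.
have := @expect_prod_affine_forms R k N (cut N) (lev N) m t L c pN.
rewrite y0 pyz => /(_ isT) H.
have /le_trans : `|expect (fun x : 'rV['F_N]_t =>
      \prod_i selberg_nu (cut N) (lev N) R (primorialn (cut N)) (affine_form L c i x)) - 1| <=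
  expR (16 ^+ m / (cut N)%:R) - 1 + (2 * m * (t * B))%:R * (lev N).+1%:R ^+ (7 * m) / N%:R.
  by apply: H => //; rewrite -/B; lia.
apply; rewrite [e in leRHS](splitr e); apply: lerD.
  apply: le_trans (hb1 (cut N) _); last by lia.
  rewrite lerD2r ler_expR; apply: ler_wpM2r; rewrite ?invr_ge0 //.
  by apply: ler_weXn2l => //; rewrite ler1n.
apply: (@le_trans _ _ (C%:R * (lev N)%:R^-1)).
  rewrite -mulrA; apply: ler_pM => //.
    by rewrite ler_nat /C; apply: leq_mul; rewrite ?leq_mul.
  by apply: level_error_le; rewrite ?m0_gt0 //; [lia | apply: prime_gt0].
have z0 : (0 : R) < (lev N)%:R by rewrite ltr0n sieve_level_gt0.
rewrite ler_pdivrMr // mulrC -ler_pdivrMr //.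
apply: le_trans (ltW (truncnS_gt _)) _; rewrite ler_nat -/b2; lia.
Qed.

(** The mean is the linear forms condition for the single form x in one variable. *)
Lemma sieve_measure_is_measure : is_measure sieve_measure.
Proof.
split; first by apply/near_prime_ooP; exists 0%N => N _ _ x; apply: sieve_measure_ge0.
apply/cvgrPdist_le => e e0; apply/near_prime_ooP.
have /near_prime_ooP[n0 h] := sieve_measure_linear_forms e0.
exists n0 => N nN pN.
have adm : admissible_coefs k (1%:M : 'M[rat]_(1, 1)).
  split=> [i j|i|i j]; last by rewrite !ord1 eqxx.
    by rewrite !ord1 mxE eqxx /=; split; rewrite normr1 lez_nat; lia.
  by apply/rV0Pn; exists 0; rewrite !mxE !ord1 eqxx oner_neq0.
have t1 : (1 <= 3 * k - 4)%N by lia.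
have := h N nN pN 1%N 1%N 1%:M (fun=> 0) m0_gt0 t1 adm.
rewrite distrC; apply: le_trans.
rewrite le_eqVlt; apply/orP; left; apply/eqP; congr `|_ - _|.
rewrite /expect card_mx mul1n expn1; congr (_ / _).
rewrite (reindex (fun x : 'rV['F_N]_1 => x 0 0)) /=; last first.
  by exists (fun a => const_mx a) => [x _|a _]; [apply/matrixP => i j; rewrite mxE !ord1 | rewrite mxE].
apply: eq_bigr => x _; rewrite big_ord1; congr (sieve_measure _).
have r1 : ratr 1 = 1 :> 'F_N by rewrite /ratr (_ : numq 1 = 1) // (_ : denq 1 = 1) // divr1.
by rewrite /affine_form big_ord1 mxE eqxx addr0 r1 mul1r.
Qed.

(** * The correlation condition *)

Section Correlation.
Variable m : nat.
Hypothesis m1 : (1 < m <= 2 ^ k.-1)%N.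
Local Notation K := (16 ^+ m : R).

Definition sieve_sup (N : nat) : R :=
  sieve_measure N [arg max_(x > (0 : 'F_N)) sieve_measure N x]%O.

Lemma sieve_sup_ge N x : sieve_measure N x <= sieve_sup N.
Proof. by rewrite /sieve_sup; case: arg_maxP => // i _; apply. Qed.

Lemma sieve_sup_ge0 N : 0 <= sieve_sup N.
Proof. exact: sieve_measure_ge0. Qed.

Definition tau_factor (N : nat) (x : 'F_N) : R :=
  sigma (cut N) (lev N) K (nat_of_ord x) ^+ (m * m).

Definition tau_const : R := expR K + (2 * m)%:R.

(** The value at 0 is the trivial bound for coinciding translates. Elsewhere [tau] is symmetric, to
    serve both representatives of a difference, and [tau_const] contains 2m for the wrap-around
    error. All values are at least 1, so real exponents may be rounded up. *)
Definition tau : ZN_family R := fun N x =>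
  if x == 0 then (1 + sieve_sup N) ^+ m
  else tau_const * (tau_factor x + tau_factor (- x)).
Arguments tau : clear implicits.

Lemma tau_factor_ge1 N (x : 'F_N) : 1 <= tau_factor x.
Proof. by rewrite exprn_ege1 // sigma_ge1. Qed.

Lemma tau_const_ge1 : 1 <= tau_const.
Proof. by apply: (@le_trans _ _ (expR K)); rewrite ?lerDl // -expR0 ler_expR exprn_ge0. Qed.

Lemma tau_ge1 N x : 1 <= tau N x.
Proof.
rewrite /tau; case: ifP => _; first by rewrite exprn_ege1 // lerDl sieve_sup_ge0.
apply: mulr_ege1; first exact: tau_const_ge1.
by apply: le_trans (tau_factor_ge1 x) _; rewrite lerDl (le_trans ler01 (tau_factor_ge1 _)).
Qed.

Lemma sum_tau_factor_le (n N : nat) : prime N -> (0 < cut N)%N ->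
  \sum_(x : 'F_N | x != 0) tau_factor x ^+ n <= N%:R * expR ((1 + K) ^+ (m * m * n)).
Proof.
move=> pN y0; set K' := (1 + K) ^+ _.
have K0 : 0 <= K by rewrite exprn_ge0.
have K'0 : 0 <= K' by rewrite exprn_ge0 // addr_ge0.
apply: (@le_trans _ _ (\sum_(x : 'F_N | x != 0) sigma (cut N) (lev N) K' (nat_of_ord x))).
  apply: ler_sum => x _; rewrite /tau_factor -exprM /sigma -prodrXl.
  apply: ler_prod => p _; have p1 : (1 : R) <= (spval p)%:R by rewrite ler1n prime_gt0 ?spval_prime.
  have p0 : 0 <= (spval p)%:R^-1 :> R by rewrite invr_ge0.
  rewrite exprn_ge0 ?addr_ge0 ?mulr_ge0 //=; apply: expr1D_le => //.
  by rewrite p0 invf_le1 // (lt_le_trans ltr01).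
rewrite (eq_bigl (fun x : 'F_N => (0 < x)%N)) => [|x]; last by rewrite lt0n -val_eqE.
apply: le_trans (sum_sigma_le (lev N) (Zp_trunc (pdiv N)).+2 y0 K'0) _.
rewrite Fp_cast //; apply: ler_wpM2l => //.
by rewrite ler_expR ler_pdivrMr ?ltr0n // ler_peMr // ler1n.
Qed.

(** The point 0 contributes O(N) to the sum because every power of sup nu is O(N); the other points
    contribute O(N) through the moments of [sigma]. *)
Lemma expect_tau_bounded (q : R) : 1 <= q ->
  exists C : R, \forall N \near prime_oo, expect (fun x => tau N x `^ q) <= C.
Proof.
move=> q1; pose n := (Num.truncn q).+1.
have [C2 C20 hC2] := selberg_nu_power R (m * n).
pose C3 := (2 * tau_const) ^+ n * 2 * expR ((1 + K) ^+ (m * m * n)).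
exists (2 ^+ (m * n) * (1 + C2) + C3).
have [n0 hn0] := near_params 2.
apply/near_prime_ooP; exists n0 => N nN pN.
have [py pz pN' pyz pW] := hn0 N nN pN.
have y0 : (0 < cut N)%N by lia.
have N0 : (0 < N)%N by exact: prime_gt0.
have NR : (0 : R) < N%:R by rewrite ltr0n.
rewrite /expect card_Fp // ler_pdivrMr //.
apply: (@le_trans _ _ (\sum_(x : 'F_N) tau N x ^+ n)).
  apply: ler_sum => x _; rewrite -powR_mulrn ?(le_trans ler01 (tau_ge1 _)) //.
  by apply: ler_powR; rewrite ?tau_ge1 // ltW // truncnS_gt.
have tc0 : 0 <= tau_const := le_trans ler01 tau_const_ge1.
have tf0 (x : 'F_N) : 0 <= tau_factor x := le_trans ler01 (tau_factor_ge1 x).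
rewrite (bigD1 0) //= mulrDl; apply: lerD.
  rewrite /tau eqxx -exprM; apply: le_trans (exprD_le _ ler01 (sieve_sup_ge0 N)) _.
  rewrite -mulrA; apply: ler_wpM2l; rewrite ?exprn_ge0 // expr1n mulrDl mul1r.
  apply: lerD; first by rewrite ler1n.
  apply: hC2.
    have zE := sieve_level_expn_le E N0.
    rewrite sieve_level_gt0 /=; apply: leq_trans zE; rewrite -[X in (X < _)%N]expn1.
    by rewrite ltn_exp2l //; have := m0_gt0; lia.
  have xN (x : 'F_N) : (x < N)%N by rewrite -[X in (_ < X)%N](Fp_cast pN) ltn_ord.
  have WN : (primorialn (cut N) <= N)%N.
    by apply: leq_trans pW; rewrite -[X in (X <= _)%N]expn1 leq_pexp2l ?primorialn_gt0.
  rewrite -mulnn; set x := [arg max_(x > _) _]%O.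
  have := leq_mul WN (xN x); rewrite mulnS; have := primorialn_gt0 (cut N); lia.
apply: (@le_trans _ _ (\sum_(x : 'F_N | x != 0)
    (2 * tau_const) ^+ n * (tau_factor x ^+ n + tau_factor (- x) ^+ n))).
  apply: ler_sum => x x0; rewrite /tau (negbTE x0) exprMn exprMn -mulrA mulrCA.
  by apply: ler_wpM2l; rewrite ?exprn_ge0 // exprD_le.
rewrite -mulr_sumr big_split /=.
have -> : \sum_(x : 'F_N | x != 0) tau_factor (- x) ^+ n = \sum_(x : 'F_N | x != 0) tau_factor x ^+ n.
  rewrite [RHS](reindex_inj (@oppr_inj _)); apply: eq_bigl => x.
  by rewrite oppr_eq0.
rewrite /C3 -!mulrA; apply: ler_wpM2l; first by rewrite exprn_ge0 // mulr_ge0.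
rewrite -mulr2n -[leLHS]mulr_natl; apply: ler_wpM2l => //.
by rewrite [leRHS]mulrC; apply: sum_tau_factor_le.
Qed.

Lemma expect_prod_le_tau : \forall N \near prime_oo, forall h : 'I_m -> 'F_N,
  expect (fun x : 'F_N => \prod_(i < m) sieve_measure N (x + h i))
    <= \sum_(i < m) \sum_(j < m | (i < j)%N) tau N (h i - h j).
Proof.
have /andP[m_gt1 m_le] := m1.
have [n0 hn0] := near_params 2.
apply/near_prime_ooP; exists n0 => N nN pN h.
have [py pz pN' pyz pW] := hn0 N nN pN.
have y0 : (0 < cut N)%N by lia.
have N0 : (0 < N)%N by exact: prime_gt0.
have tau0 x : 0 <= tau N x := le_trans ler01 (tau_ge1 x).
case: (pickP (fun ij : 'I_m * 'I_m => (ij.1 < ij.2)%N && (h ij.1 == h ij.2))) => [[i j] /= /andP[ij /eqP hij]|distinct].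
  rewrite (bigD1 i) //= (bigD1 j) //= -addrA.
  apply: (@le_trans _ _ (tau N (h i - h j))); last first.
    by rewrite lerDl addr_ge0 ?sumr_ge0 // => ? _; rewrite sumr_ge0.
  rewrite hij subrr /tau eqxx /expect card_Fp // ler_pdivrMr ?ltr0n //.
  have -> : (1 + sieve_sup N) ^+ m * N%:R = \sum_(x : 'F_N) (1 + sieve_sup N) ^+ m.
    by rewrite sumr_const card_Fp // mulr_natr.
  apply: ler_sum => x _; rewrite -[m in X in _ <= X]card_ord -prodr_const.
  apply: ler_prod => l _; rewrite sieve_measure_ge0 /=.
  by apply: le_trans (sieve_sup_ge _) _; rewrite lerDr.
have := expect_prod_translates R h pN y0 pyz m_gt1.
set Sig := \sum_(i < m) _ => H; apply: le_trans H _.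
apply: (@le_trans _ _ (tau_const * Sig)); last first.
  rewrite mulr_sumr; apply: ler_sum => i _; rewrite mulr_sumr; apply: ler_sum => j ij.
  have := distinct (i, j); rewrite /= ij /= => /negbT hij.
  by rewrite /tau subr_eq0 (negbTE hij) opprB.
(* The wrap-around error is at most 2m, and [Sig] is at least 1, so the term 2m of [tau_const]
   absorbs it. *)
rewrite mulrDl lerD2l.
have Sig1 : 1 <= Sig.
  pose i0 : 'I_m := Ordinal (ltnW m_gt1); pose j0 : 'I_m := Ordinal m_gt1.
  have s1 (x : 'F_N) : 1 <= tau_factor x := tau_factor_ge1 x.
  have s0 (x : 'F_N) : 0 <= tau_factor x := le_trans ler01 (s1 x).
  have t0 i j : 0 <= tau_factor (h i - h j) + tau_factor (h j - h i) by rewrite addr_ge0.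
  rewrite /Sig (bigD1 i0) //= (bigD1 j0) //= -!addrA.
  apply: le_trans (s1 (h i0 - h j0)) _; rewrite lerDl.
  apply: addr_ge0; first exact: (s0 (h j0 - h i0)).
  apply: addr_ge0; first by apply: sumr_ge0 => j _; apply: t0.
  by apply: sumr_ge0 => i _; apply: sumr_ge0 => j _; apply: t0.
apply: (@le_trans _ _ (2 * m)%:R); last by rewrite ler_peMr.
rewrite -mulrA ler_piMr //.
apply: le_trans (level_error_le R m0_gt0 _ _ N0) _; [| by lia |].
  by apply: leq_trans m_le _; rewrite leq_pmull //; lia.
by rewrite invf_le1 ?ltr0n ?sieve_level_gt0 // ler1n sieve_level_gt0.
Qed.

End Correlation.

Lemma sieve_measure_correlation : correlation_condition (2 ^ k.-1) sieve_measure.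
Proof.
move=> m m1; exists (tau m); split.
- by apply/near_prime_ooP; exists 0%N => N _ _ x; apply: le_trans ler01 (tau_ge1 _ _).
- by move=> q q1; apply: expect_tau_bounded.
- exact: expect_prod_le_tau.
Qed.

Lemma sieve_measure_majorant : \forall N \near prime_oo, forall n : nat,
  eps R k * N%:R <= n%:R <= 2 * eps R k * N%:R ->
  k%:R^-1 * 2 ^- (k + 5) * modified_von_Mangoldt (w N) n <= sieve_measure N n%:R.
Proof.
have eps0 : 0 < eps R k by rewrite invr_gt0 mulr_gt0 ?exprn_gt0 // ltr0n fact_gt0.
(* z >= 4 is needed for [level_dominates]; z > 1/eps gives n >= eps N >= eps z^2 > z, so that the
   prime Wn+1 exceeds every sieve prime. *)
pose b := (4 + (Num.truncn (eps R k)^-1).+1)%N.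
have [n0 hn0] := near_params b.
apply/near_prime_ooP; exists n0 => N nN pN n /andP[nl nu].
have [py pz pN' pyz pW] := hn0 N nN pN.
have N0 : (0 < N)%N by exact: prime_gt0.
have NR : (0 : R) < N%:R by rewrite ltr0n.
rewrite /modified_von_Mangoldt; case: ifP => pr; last by rewrite mulr0 sieve_measure_ge0.
change (primorial (w N)) with (primorialn (cut N)) in pr |- *.
set y := cut N in py pyz pW pr *; set z := lev N in pz pyz *.
have zE : (z ^ E <= N)%N := sieve_level_expn_le E N0.
have NzE : (N < 2 ^ E * z ^ E)%N by apply: ltn_sieve_level; rewrite muln_gt0 m0_gt0.
have z0 : (0 < z)%N by lia.
have m00 := m0_gt0.
have E2 : (2 <= E)%N by apply: leq_trans (leq_mul (leqnn 32) m00).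
have z4 : (4 <= z)%N by lia.
have zR : (0 : R) < z%:R by rewrite ltr0n.
have zzN : (z ^ 2 <= N)%N.
  by apply: leq_trans zE; rewrite leq_exp2l // (leq_trans _ z4).
have zn : (z < n)%N.
  rewrite -(ltr_nat R); apply: lt_le_trans nl.
  apply: (@lt_le_trans _ _ (eps R k * (z ^ 2)%N%:R)); last first.
    by apply: ler_wpM2l; [exact: ltW | rewrite ler_nat].
  rewrite natrX expr2 mulrA -[ltLHS]mul1r ltr_pM2r // mulrC -ltr_pdivrMr // div1r.
  by apply: lt_le_trans (truncnS_gt _) _; rewrite ler_nat; apply: leq_trans pz; apply: leq_addl.
have nN' : (n < N)%N.
  rewrite -(ltr_nat R); apply: le_lt_trans nu _; rewrite -[ltRHS]mul1r ltr_pM2r //.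
  rewrite /eps ltr_pdivrMr ?mulr_gt0 ?exprn_gt0 ?ltr0n ?fact_gt0 // mul1r.
  apply: (@lt_le_trans _ _ (2 ^+ k)).
    by rewrite -[ltLHS]expr1 ltr_eXn2l; [lia | rewrite ltr1n].
  by rewrite ler_peMr ?exprn_ge0 // ler1n fact_gt0.
have WnE : (primorialn y * n + 1 <= z ^ (2 * E))%N.
  have W0 := primorialn_gt0 y.
  apply: (@leq_trans (primorialn y * N)).
    by have := leq_mul (leqnn (primorialn y)) nN'; rewrite mulnS; lia.
  by apply: level_dominates NzE => //; apply: ltnW.
have nuE : sieve_measure N n%:R = selberg_sum y z R.
  rewrite /sieve_measure /selberg_nu val_Fp_nat // modn_small // -/y -/z.
  rewrite (_ : [set p | _] = set0).
    rewrite (eq_bigl (pred1 set0)) => [|I]; last by rewrite subset0.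
    by rewrite big_pred1_eq /selberg_weight (sieve_weight0 (@spvalR_ge2 y z R) (slevel0 y z0)) expr1n mulr1.
  apply/setP => p; rewrite !inE; apply/negbTE/negP => pW'.
  have := pW'; rewrite dvdn_prime2 ?spval_prime // => /eqP pe.
  have := spval_le p; rewrite pe -/z => h.
  by have := leq_mul (primorialn_gt0 y) (leqnn n); rewrite mul1n; lia.
rewrite nuE; apply: le_trans (ln_le_selberg_sum R pyz).
have f0 : 0 <= (totient (primorialn y))%:R / (primorialn y)%:R :> R by rewrite divr_ge0.
rewrite mulrCA; apply: ler_wpM2l => //.
(* 2E = 64 k 2^(k-1) = k 2^(k+5): the constant of the theorem is exactly the loss in ln (Wn+1) <= 2E
   ln z. *)
have cE : k%:R^-1 * 2 ^- (k + 5) = (2 * E)%:R^-1 :> R.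
  rewrite -invfM -natrX -natrM; congr (_%:R^-1).
  rewrite [(2 * E)%N](_ : _ = 64 * m0)%N; last by ring.
  have -> : (k + 5 = 6 + k.-1)%N by lia.
  by rewrite expnD mulnCA.
rewrite cE mulrC ler_pdivrMr; last by rewrite ltr0n muln_gt0 muln_gt0 m0_gt0.
apply: (@le_trans _ _ (ln (z%:R ^+ (2 * E)))).
  by rewrite ler_ln ?posrE ?exprn_gt0 ?ltr0n ?addn1 // -natrX ler_nat -addn1.
rewrite lnXn // -[leLHS]mulr_natr; apply: ler_wpM2r => //.
by rewrite ler_ln ?posrE ?ltr0n // ler_nat.
Qed.

End Final.

Local Open Scope classical_set_scope.
Local Open Scope ring_scope.

Theorem proposition9p1 (R : realType) (k : nat) (hk : (3 <= k)%N) :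
  exists w0 : nat -> R,
    w0 N @[N --> prime_oo] --> +oo /\
    forall w : nat -> R,
      w N @[N --> prime_oo] --> +oo ->
      (\forall N \near prime_oo, w N <= w0 N) ->
      exists nu : ZN_family R,
        pseudorandom k nu /\
        \forall N \near prime_oo, forall n : nat,
          eps R k * N%:R <= n%:R <= 2 * eps R k * N%:R ->
          k%:R^-1 * 2 ^- (k + 5) * modified_von_Mangoldt (w N) n
            <= nu N n%:R.
Proof.
exists (fun N => (max_cutoff (32 * (k * 2 ^ k.-1)) N)%:R); split.
  by apply/cvgryPge => A; apply: near_max_cutoff_ge; rewrite muln_gt0 m0_gt0.
move=> w /cvgryPge w_oo w_le; exists (sieve_measure k w); split.
  split.
  - exact: sieve_measure_is_measure.
  - exact: sieve_measure_linear_forms.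
  - exact: sieve_measure_correlation.
exact: sieve_measure_majorant.
Qed.
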